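(* Let $(\Pi,\Sigma)$ be a Coxeter system. Any subword complex $\Delta(Q,\pi)$, where $Q=(\sigma_1,\dots,\sigma_m)$ is a word in $\Sigma$ and $\pi\in\Pi$, is vertex-decomposable. In particular, subword complexes are shellable and therefore Cohen–Macaulay.
   Context: In a Coxeter system $(\Pi,\Sigma)$, $\Pi$ is a Coxeter group and $\Sigma$ is a set of simple reflections, which generate $\Pi$. A word of size $m$ is an ordered sequence $Q=(\sigma_1,\dots,\sigma_m)$ of elements of $\Sigma$; $Q$ need not be a reduced expression. An ordered subsequence $P$ of $Q$ is called a subword of $Q$; it is identified with its set of positions in $Q$, so $Q\setminus P$ denotes the complementary subsequence. $P$ represents $\pi\in\Pi$ if the ordered product of the simple reflections in $P$ is a reduced decomposition for $\pi$; $P$ contains $\pi$ if some subsequence of $P$ represents $\pi$. The subword complex $\Delta(Q,\pi)$ is the set of subwords $P\subseteq Q$ whose complements $Q\setminus P$ contain $\pi$. For a simplicial complex $\Delta$ and a face $F\in\Delta$, the deletion of $F$ from $\Delta$ is $\mathrm{del}(F,\Delta)=\{G\in\Delta\mid G\cap F=\varnothing\}$ and the link of $F$ in $\Delta$ is $\mathrm{link}(F,\Delta)=\{G\in\Delta\mid G\cap F=\varnothing\text{ and }G\cup F\in\Delta\}$. $\Delta$ is pure if all its facets (maximal faces) have the same dimension. $\Delta$ is vertex-decomposable (a recursive definition) if $\Delta$ is pure and either (1) $\Delta=\{\varnothing\}$, or (2) for some vertex $v\in\Delta$, both $\mathrm{del}(v,\Delta)$ and $\mathrm{link}(v,\Delta)$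 are vertex-decomposable. A shelling of $\Delta$ is an ordered list $F_1,F_2,\dots,F_t$ of its facets such that $\bigcup_{j<i}F_j\cap F_i$ is a union of codimension 1 faces of $F_i$ for each $i\le t$. $\Delta$ is shellable if it is pure and has a shelling. $\Delta$ is Cohen–Macaulay if its Stanley–Reisner ring (the polynomial ring over a field $\Bbbk$, arbitrary here, with variables indexed by the vertex set, modulo the ideal generated by the squarefree monomials whose supports are not faces of $\Delta$) is Cohen–Macaulay.
   Formalization: Vertex-decomposability is asserted only when Q contains π: otherwise Δ(Q,π) has no faces at all, so it is neither {∅} nor has a vertex, and is not vertex-decomposable by the given definition. Shellability and Cohen–Macaulayness are asserted for every Q and π. *)

(* Defs.v *)
From HB Require Import structures.
From mathcomp Require Import all_boot all_order all_algebra.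
From mathcomp Require Import boolp mpoly.

Set Implicit Arguments.
Unset Strict Implicit.
Unset Printing Implicit Defensive.

Import GRing.Theory.

Section Coxeter.
Local Open Scope group_scope.

Variables (W : groupType) (S : W -> Prop).

Definition word (u : seq W) : Prop := forall s, s \in u -> S s.

(* The matrix entry 0 encodes m(s, t) = oo: the relation (s t) ^ 0 = 1 is
   void. Only the entries with both indices in S are meaningful. *)
Definition coxeter_matrix (m : W -> W -> nat) : Prop :=
  forall s t, S s -> S t -> m s t = m t s /\ (m s t = 1%N <-> s = t).

Definition coxeter_relations (m : W -> W -> nat) (G : groupType)
    (f : W -> G) : Prop :=
  forall s t, S s -> S t -> (f s * f t) ^+ m s t = 1.

(* W = < S | (s t) ^ m(s, t) = 1 >, the presentation being expressed by its
   universal property. Uniqueness of phi follows from generation. *)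
Definition coxeter_system : Prop :=
  (forall w : W, exists2 u, word u & \prod_(s <- u) s = w) /\
  exists m : W -> W -> nat,
    [/\ coxeter_matrix m,
        coxeter_relations m id &
        forall (G : groupType) (f : W -> G), coxeter_relations m f ->
          exists phi : {multiplicative W -> G},
            forall s, S s -> phi s = f s].

Definition reduced_decomposition (u : seq W) (w : W) : Prop :=
  [/\ word u, \prod_(s <- u) s = w &
      forall v, word v -> \prod_(s <- v) s = w -> size u <= size v].

Definition contains (u : seq W) (w : W) : Prop :=
  exists2 v, subseq v u & reduced_decomposition v w.

(* The subword of Q at the positions P; enum P lists P increasingly. *)
Definition subword (m : nat) (Q : m.-tuple W) (P : {set 'I_m}) : seq W :=
  [seq tnth Q i | i <- enum P].

Definition subword_complex (m : nat) (Q : m.-tuple W) (w : W) :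
    {set {set 'I_m}} :=
  [set P | `[< contains (subword Q (~: P)) w >]].

End Coxeter.

(* A complex with vertices in T is the set of its faces. The void complex set0
   (no face at all) differs from [set set0], whose only face is empty. *)
Section Complexes.
Variable T : finType.
Implicit Types (D : {set {set T}}) (F G : {set T}).

Definition del F D := [set G in D | G :&: F == set0].

Definition link F D := [set G in D | (G :&: F == set0) && (G :|: F \in D)].

Definition facets D := [set F | maxset (mem D) F].

Definition pure D : Prop := {in facets D &, forall F G, #|F| = #|G|}.

Inductive vertex_decomposable : {set {set T}} -> Prop :=
| VDEmptyFace D : pure D -> D = [set set0] -> vertex_decomposable D
| VDVertex D (v : T) : pure D -> [set v] \in D ->
    vertex_decomposable (del [set v] D) ->
    vertex_decomposable (link [set v] D) -> vertex_decomposable D.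

(* A face stands for its simplex, i.e. the complex of all its subsets. *)
Definition shelling D (s : seq {set T}) : Prop :=
  [/\ uniq s, s =i facets D &
      forall i, i < size s -> let Fi := nth set0 s i in
        exists2 C : {set {set T}},
          {in C, forall G, G \subset Fi /\ #|G|.+1 = #|Fi|} &
          (\bigcup_(F <- take i s) powerset F) :&: powerset Fi
            = \bigcup_(G in C) powerset G].

Definition shellable D : Prop := pure D /\ exists s, shelling D s.

End Complexes.

Local Open Scope ring_scope.

Section Ideals.
Variable A : comPzRingType.
Implicit Types (I P G : A -> Prop) (s : seq A).

Definition ideal I : Prop :=
  [/\ I 0, forall x y, I x -> I y -> I (x + y) & forall a x, I x -> I (a * x)].

Definition ideal_gen G (x : A) : Prop :=
  forall I, ideal I -> (forall g, G g -> I g) -> I x.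

Definition prime_ideal P : Prop :=
  [/\ ideal P, ~ P 1 & forall x y, P (x * y) -> P x \/ P y].

Definition maximal_ideal P : Prop :=
  [/\ ideal P, ~ P 1 &
      forall I, ideal I -> ~ I 1 -> (forall x, P x -> I x) ->
        forall x, I x -> P x].

Definition noetherian : Prop :=
  forall I, ideal I ->
    exists s, forall x, I x <-> ideal_gen (fun g => g \in s) x.

Definition proper_sub I P : Prop :=
  (forall x, I x -> P x) /\ (exists2 x, P x & ~ I x).

Definition prime_chain P (n : nat) : Prop :=
  exists p : nat -> A -> Prop,
    [/\ forall i, (i <= n)%N -> prime_ideal (p i),
        forall i, (i < n)%N -> proper_sub (p i) (p i.+1) &
        p n = P].

Definition height_eq P (d : nat) : Prop :=
  prime_chain P d /\ forall n, prime_chain P n -> (n <= d)%N.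

Definition regular_seq s : Prop :=
  ~ ideal_gen (fun g => g \in s) 1 /\
  forall i, (i < size s)%N -> forall a,
    ideal_gen (fun g => g \in take i s) (s`_i * a) ->
    ideal_gen (fun g => g \in take i s) a.

Definition depth_eq P (d : nat) : Prop :=
  (exists s, [/\ regular_seq s, forall x, x \in s -> P x & size s = d]) /\
  forall s, regular_seq s -> (forall x, x \in s -> P x) -> (size s <= d)%N.

(* The definition of Eisenbud, Commutative Algebra, section 18.2: A is
   Noetherian and depth P = codim P for every maximal ideal P. This equals
   depth A_P = dim A_P, so no localization is needed. The zero ring, having no
   maximal ideal, is Cohen-Macaulay. *)
Definition cohen_macaulay : Prop :=
  noetherian /\
  forall P, maximal_ideal P -> exists d, height_eq P d /\ depth_eq P d.

End Ideals.

(* The ideal quotients of ring_quotient.v are restricted to proper ideals; here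
   the generated ideal may be the whole ring. *)
Section Quotient.
Local Open Scope quotient_scope.
Variables (A : comPzRingType) (G : A -> Prop).

Definition ideal_genb : {pred A} := fun x => `[< ideal_gen G x >].

Lemma ideal_gen_ideal : ideal (ideal_gen G).
Proof.
split=> [I [] //|x y Ix Iy I hI sG|a x Ix I hI sG]; have [_ hD hM] := hI.
  by apply: hD; [apply: Ix|apply: Iy].
by apply: hM; apply: Ix.
Qed.

Lemma ideal_genb_zmod : zmod_closed ideal_genb.
Proof.
have [h0 hD hM] := ideal_gen_ideal.
split=> [|x y /asboolP hx /asboolP hy]; apply/asboolP => //.
by apply: hD => //; rewrite -mulN1r; apply: hM.
Qed.

HB.instance Definition _ := GRing.isZmodClosed.Build A ideal_genb
  ideal_genb_zmod.

Lemma ideal_genbM a x : x \in ideal_genb -> a * x \in ideal_genb.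
Proof.
by move=> /asboolP hx; apply/asboolP; have [_ _] := ideal_gen_ideal; apply.
Qed.

Definition quot_ring : Type := {ideal_quot ideal_genb}.

HB.instance Definition _ := ZmodQuotient.on quot_ring.

Definition quot_one : quot_ring := \pi_quot_ring 1.
Definition quot_mul (x y : quot_ring) : quot_ring :=
  \pi_quot_ring (repr x * repr y).

Lemma quot_eqE (x y : A) :
  (\pi_quot_ring x == \pi_quot_ring y) = (x - y \in ideal_genb).
Proof. by rewrite (Quotient.idealrBE ideal_genb). Qed.

Lemma quot_piM (x y : A) :
  quot_mul (\pi_quot_ring x) (\pi_quot_ring y) = \pi_quot_ring (x * y).
Proof.
have hr z : repr (\pi_quot_ring z) - z \in ideal_genb.
  by rewrite -quot_eqE reprK.
apply/eqP; rewrite quot_eqE.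
set a := repr _; set b := repr _.
have -> : a * b - x * y = a * (b - y) + y * (a - x).
  by rewrite !mulrBr addrA (mulrC y a) subrK (mulrC y x).
by rewrite rpredD //; apply: ideal_genbM; apply: hr.
Qed.

Lemma quot_piD (x y : A) :
  \pi_quot_ring x + \pi_quot_ring y = \pi_quot_ring (x + y).
Proof. by rewrite [in RHS]pi_addr. Qed.

Lemma quot_mulA : associative quot_mul.
Proof.
elim/quotW=> x; elim/quotW=> y; elim/quotW=> z.
by rewrite (quot_piM y z) (quot_piM x y) !quot_piM mulrA.
Qed.

Lemma quot_mulC : commutative quot_mul.
Proof.
by elim/quotW=> x; elim/quotW=> y; rewrite (quot_piM x y) (quot_piM y x) mulrC.
Qed.

Lemma quot_mul1 : left_id quot_one quot_mul.
Proof. by elim/quotW=> x; rewrite (quot_piM 1 x) mul1r. Qed.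

Lemma quot_mulDl : left_distributive quot_mul +%R.
Proof.
elim/quotW=> x; elim/quotW=> y; elim/quotW=> z.
by rewrite quot_piD (quot_piM x z) (quot_piM y z) quot_piM quot_piD mulrDl.
Qed.

HB.instance Definition _ := GRing.Zmodule_isComPzRing.Build quot_ring
  quot_mulA quot_mulC quot_mul1 quot_mulDl.

End Quotient.

Section StanleyReisner.
Variables (k : fieldType) (n : nat) (D : {set {set 'I_n}}).

Definition nonface_monomial (f : {mpoly k[n]}) : Prop :=
  exists2 F : {set 'I_n}, F \notin D & f = \prod_(i in F) 'X_i.

(* All of 'I_n serves as the vertex set: if [set i] is not a face then 'X_i is
   a generator of the ideal, so the variable i vanishes in the quotient. *)
Definition stanley_reisner_ring : comPzRingType := quot_ring nonface_monomial.

End StanleyReisner.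

(* Main.v *)
Require Import Defs.
From HB Require Import structures.
From mathcomp Require Import all_boot all_order all_algebra.
From mathcomp Require Import boolp mpoly ring.
From mathcomp Require classical_sets.

(* If s is the first letter of Q = s Q', the link of s in Delta(Q, w) is
   Delta(Q', w) and its deletion is Delta(Q', s w) or Delta(Q', w) according to
   whether some reduced word of w starts with s; this rests on the exchange
   property, read off from the action of the group on its reflections, and gives
   vertex-decomposability by induction. A vertex-decomposable complex is shelled
   by a shelling of the deletion followed by the cone over one of the link.

   Let D be shellable with facets of size d and M a maximal ideal of k[x_1, ..,
   x_n]. By Zariski's lemma M contains, for each i, a monic polynomial f_i(x_i)
   without constant term. The elementary symmetric functions e_d, .., e_1 of the
   f_i form a regular sequence on k[x_F] for each facet F: killing the factors
   of e_d = prod_(i in F) f_i one at a time reduces to smaller F. Adding a facet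
   to a shelling gives an exact sequence 0 -> k[x_F] -> k[D'] -> k[D] -> 0, so
   the sequence is regular on k[D]. Regular sequences in a prime ideal yield
   chains of primes below it, and the number of monomials of bounded degree in
   k[D] forces any d + 1 elements to be algebraically dependent, which bounds
   such chains by d. Hence depth and height of every maximal ideal are d. *)

Set Implicit Arguments.
Unset Strict Implicit.
Unset Printing Implicit Defensive.

(** * The exchange property of Coxeter groups *)

Section CocycleGroup.
Local Open Scope group_scope.
Variable W : groupType.

(* The semidirect product of the functions W -> bool, added pointwise, by W
   acting on their argument by conjugation. *)
Definition cocycle_group : Type := (W * (W -> bool))%type.

HB.instance Definition _ := gen_eqMixin cocycle_group.
HB.instance Definition _ := gen_choiceMixin cocycle_group.

Definition cocycle_mul (g h : cocycle_group) : cocycle_group :=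
  (g.1 * h.1, fun x => g.2 x (+) h.2 (x ^ g.1)).
Definition cocycle_one : cocycle_group := (1, fun=> false).
Definition cocycle_inv (g : cocycle_group) : cocycle_group :=
  (g.1^-1, fun x => g.2 (x ^ g.1^-1)).

Lemma cocycle_mulA : associative cocycle_mul.
Proof.
move=> g h l; congr pair; first by rewrite /= mulgA.
by apply/funext=> x /=; rewrite conjgM addbA.
Qed.

Lemma cocycle_mul1g : left_id cocycle_one cocycle_mul.
Proof.
move=> [w e]; congr pair; first by rewrite /= mul1g.
by apply/funext=> x /=; rewrite conjg1.
Qed.

Lemma cocycle_mulg1 : right_id cocycle_one cocycle_mul.
Proof.
move=> [w e]; congr pair; first by rewrite /= mulg1.
by apply/funext=> x /=; rewrite addbF.
Qed.

Lemma cocycle_mulVg : left_inverse cocycle_one cocycle_inv cocycle_mul.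
Proof.
move=> [w e]; congr pair; first by rewrite /= mulVg.
by apply/funext=> x /=; rewrite addbb.
Qed.

Lemma cocycle_mulgV : right_inverse cocycle_one cocycle_inv cocycle_mul.
Proof.
move=> [w e]; congr pair; first by rewrite /= mulgV.
by apply/funext=> x /=; rewrite conjgK addbb.
Qed.

HB.instance Definition _ := isGroup.Build cocycle_group
  cocycle_mulA cocycle_mul1g cocycle_mulg1 cocycle_mulVg cocycle_mulgV.

End CocycleGroup.

Section Exchange.
Local Open Scope group_scope.
Variables (W : groupType) (S : W -> Prop).
Hypothesis hS : coxeter_system S.
Implicit Types (s t w x : W) (u v : seq W).

Let refl_cocycle (s : W) : cocycle_group W := (s, fun x => x == s).

Lemma simple_sqr s : S s -> s * s = 1.
Proof.
have [_ [m [hm hr _]]] := hS => Ss.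
have [_ [_ /(_ erefl) m1]] := hm s s Ss Ss.
by have := hr s s Ss Ss; rewrite m1.
Qed.

Lemma simple_inv s : S s -> s^-1 = s.
Proof. by move=> Ss; rewrite -[LHS]mul1g -(simple_sqr Ss) mulgK. Qed.

Lemma conjg_eq (x y z : W) : (x ^ y == z) = (x == z ^ y^-1).
Proof. exact: can2_eq (conjgK y) (conjgKV y) x z. Qed.

(** The product of n pairs sees the reflections (s t)^i s for i < 2n: one more pair in front
    conjugates by s t, which shifts i by 2, and contributes the indices 0 and 1. *)
Lemma refl_cocycle_exp s t n : S s -> S t ->
  (refl_cocycle s * refl_cocycle t) ^+ n
  = ((s * t) ^+ n,
     fun x => \big[addb/false]_(i < n.*2) (x == (s * t) ^+ i * s)).
Proof.
move=> Ss St; elim: n => [|n IHn].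
  by rewrite !expg0; congr pair; apply/funext=> x; rewrite big_ord0.
rewrite expgS IHn; congr pair; first by rewrite -expgS.
apply/funext=> x /=.
rewrite doubleS !big_ord_recl /= expg0 mul1g -addbA; congr (_ (+) (_ (+) _)).
  by rewrite conjg_eq conjgE invgK simple_inv // mulgA.
apply: eq_bigr => i _; rewrite conjg_eq conjgE invgK invgM !simple_inv //.
have -> : (s * t) ^+ i * s * (t * s) = (s * t) ^+ i.+1 * s.
  by rewrite expgSr !mulgA.
by rewrite mulgA -expgS.
Qed.

(** The Coxeter relations hold for [refl_cocycle]: as (s t)^m = 1 for m = [m s t], the reflections
    of index i and m + i coincide and cancel modulo 2. *)
Lemma exists_reflection_cocycle :
  exists phi : {multiplicative W -> cocycle_group W},
    forall s, S s -> phi s = (s, fun x => x == s).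
Proof.
have [_ [m [_ hr /(_ _ refl_cocycle) hphi]]] := hS; apply: hphi => s t Ss St.
rewrite refl_cocycle_exp // hr //; congr pair; apply/funext=> x.
rewrite -addnn big_split_ord /=
  -[RHS](addbb (\big[addb/false]_(i < m s t) (x == (s * t) ^+ i * s))).
by congr (_ (+) _); apply: eq_bigr => i _; rewrite expgnDr hr // mul1g.
Qed.

(** For a word s_1 .. s_r, entry i is (s_1 .. s_{i-1}) s_i (s_1 .. s_{i-1})^-1. *)
Fixpoint reflections u :=
  if u is s :: u' then s :: [seq x ^ s^-1 | x <- reflections u'] else [::].

(** The parities form the second component of [phi] at the product of the word, hence depend on that
    product only. *)
Lemma reflection_parity u v : word S u -> word S v ->
    \prod_(s <- u) s = \prod_(s <- v) s ->
  forall x, odd (count_mem x (reflections u))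
            = odd (count_mem x (reflections v)).
Proof.
have [phi hphi] := exists_reflection_cocycle => hu hv huv x.
have phi1 : phi 1 = 1 by apply: (mulgI (phi 1)); rewrite -gmulfM !mulg1.
have key (w : seq W) : word S w -> phi (\prod_(s <- w) s) =
  (\prod_(s <- w) s, fun x => odd (count_mem x (reflections w))).
  elim: w => [|s w IHw] hw; first by rewrite big_nil phi1.
  have Ss : S s by apply: hw; rewrite inE eqxx.
  rewrite !big_cons gmulfM hphi // IHw; last by move=> y yw; apply: hw;
    rewrite inE yw orbT.
  congr pair; apply/funext=> y /=; rewrite oddD oddb eq_sym;
    congr (_ (+) odd _).
  by rewrite count_map; apply: eq_count => z /=; rewrite conjg_eq invgK eq_sym.
by have := key u hu; rewrite huv key // => -[/(congr1 (@^~ x))].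
Qed.

(* The reflection at position i of the list sends the product of u to the
   product of u with its i-th letter deleted. *)
Lemma reflections_del x u : x \in reflections u -> word S u ->
  exists2 v, subseq v u &
    size u = (size v).+1 /\ \prod_(s <- v) s = x * \prod_(s <- u) s.
Proof.
elim: u x => [|t u IHu] x //= /[swap] hu.
have St : S t by apply: hu; rewrite inE eqxx.
have hu' : word S u by move=> y yw; apply: hu; rewrite inE yw orbT.
rewrite inE; case: eqVneq => [-> _|_ /mapP[r ru ->]] /=.
  exists u; first exact: subseq_cons.
  by split=> //; rewrite big_cons mulgA simple_sqr // mul1g.
have [v vu [size_u prod_v]] := IHu r ru hu'.
exists (t :: v); first by rewrite /= eqxx.
by rewrite size_u !big_cons prod_v conjgE invgK -!mulgA mulKg.
Qed.

Lemma word_subseq u v : subseq u v -> word S v -> word S u.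
Proof. by move=> /mem_subseq uv hv s /uv; apply: hv. Qed.

Lemma word_cons s u : word S (s :: u) <-> S s /\ word S u.
Proof.
split=> [hu|[Ss hu] t]; last by rewrite inE => /predU1P[->|/hu].
by split=> [|t tu]; apply: hu; rewrite inE ?eqxx // tu orbT.
Qed.

(** The reflection [s] occurs exactly once along the reduced word [s :: v], so by parity it occurs
    along [u], where it deletes a letter. *)
Lemma exchange s v u w : reduced_decomposition S (s :: v) w ->
    word S u -> \prod_(t <- u) t = w ->
  exists2 u', subseq u' u &
    size u = (size u').+1 /\ \prod_(t <- u') t = s * w.
Proof.
move=> [hsv prod_sv min_sv] hu prod_u.
have [Ss hv] := (word_cons s v).1 hsv.
suff /reflections_del/(_ hu) : s \in reflections u by rewrite prod_u.
rewrite -has_pred1 has_count; apply: odd_gt0.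
rewrite (reflection_parity hu hsv) ?prod_u ?prod_sv //= eqxx oddD /=.
(* A second occurrence would make [s] a reflection of [v]; deleting the corresponding letter of [v]
   would then express [w] by fewer letters than [s :: v]. *)
rewrite (count_memPn _) //; apply/mapP=> -[y yv /esym/eqP].
rewrite conjg_eq invgK conjgE mulKg => /eqP y_s; move: yv; rewrite y_s.
move=> /reflections_del/(_ hv)[v' v'v [size_v prod_v']].
have := min_sv v' (word_subseq v'v hv).
by rewrite prod_v' -prod_sv big_cons /= size_v => /(_ erefl)/ltnW; rewrite ltnn.
Qed.

Lemma reduced_behead s v w :
  reduced_decomposition S (s :: v) w -> reduced_decomposition S v (s * w).
Proof.
move=> [/word_cons[Ss hv] prod_sv min_sv]; split=> // [|u hu prod_u].
  by rewrite -prod_sv big_cons mulgA simple_sqr // mul1g.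
rewrite -ltnS; apply: (min_sv (s :: u)); first exact/word_cons.
by rewrite big_cons prod_u mulgA simple_sqr // mul1g.
Qed.

(** If a reduced word of [w] in [s :: u] skips the first letter, the exchange property deletes one
    of its letters and leaves a reduced word of s w; if it uses the first letter, dropping that
    letter does the same. *)
Lemma contains_cons_descent s v u w : reduced_decomposition S (s :: v) w ->
  word S u -> contains S (s :: u) w <-> contains S u (s * w).
Proof.
move=> red_sv hu; have [/word_cons[Ss hv] prod_sv min_sv] := red_sv.
have [_ prod_v min_v] := reduced_behead red_sv; split=> [[r r_su]|[r ru]].
  move=> red_r.
  case: (boolP (subseq r u)) => [ru|not_ru]; last first.
    case: r => [|t r] in red_r r_su not_ru *;
      first by rewrite sub0seq in not_ru.
    move: r_su not_ru => /=; case: eqVneq => [ts ru _|_ ->//].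
    by exists r; rewrite // -ts; apply: reduced_behead.
  have [hr prod_r min_r] := red_r.
  have [r' r'r [size_r prod_r']] := exchange red_sv hr prod_r.
  exists r'; first exact: subseq_trans ru.
  split=> // [|q hq prod_q]; first exact: word_subseq r'r hr.
  rewrite -ltnS -size_r; apply: (min_r (s :: q)); first exact/word_cons.
  by rewrite big_cons prod_q mulgA simple_sqr // mul1g.
move=> [hr prod_r min_r]; exists (s :: r); first by rewrite /= eqxx.
split; first exact/word_cons.
  by rewrite big_cons prod_r mulgA simple_sqr // mul1g.
move=> q hq prod_q; apply: leq_trans (min_sv _ hq prod_q).
by rewrite ltnS; apply: min_r.
Qed.

(** A reduced word of [w] inside [s :: u] cannot use the first letter, as it would then start with
    [s]. *)
Lemma contains_cons_ascent s u w :
  ~ (exists v, reduced_decomposition S (s :: v) w) ->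
  contains S (s :: u) w <-> contains S u w.
Proof.
move=> asc; split=> [[[|t r] r_su red_r]|[r ru red_r]].
- by exists [::]; rewrite ?sub0seq.
- move: r_su => /=; case: eqVneq red_r => [-> red_r _|_ red_r ru].
    by case: asc; exists r.
  by exists (t :: r).
- by exists r => //; apply: subseq_trans ru (subseq_cons _ _).
Qed.

End Exchange.

(** * Vertex-decomposability of subword complexes *)

Definition simplicial_complex (T : finType) (D : {set {set T}}) :=
  forall F G : {set T}, G \subset F -> F \in D -> G \in D.

Lemma setI1_eq0 (T : finType) (G : {set T}) (i : T) :
  (G :&: [set i] == set0) = (i \notin G).
Proof. by rewrite setI_eq0 disjoint_sym disjoints1. Qed.

Section PositionComplex.
Variables (W : groupType) (S : W -> Prop) (T : finType) (q : T -> W).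
Hypotheses (hS : coxeter_system S) (hq : forall i, S (q i)).
Implicit Types (l : seq T) (w : W) (F G P : {set T}).

Definition complement_word l P := [seq q i | i <- l & i \notin P].

(** The subword complex of the word read along the positions [l]. The vertex type stays fixed while
    the induction removes positions from [l]. *)
Definition position_complex l w : {set {set T}} :=
  [set P : {set T} | (P \subset l) &&
    `[< contains S (complement_word l P) w >]].

Lemma position_complexP l w P :
  reflect (P \subset l /\ contains S (complement_word l P) w)
          (P \in position_complex l w).
Proof.
by rewrite inE; apply: (iffP andP) => -[Pl /asboolP hP]; split.
Qed.

Lemma word_map l : word S [seq q i | i <- l].
Proof. by move=> _ /mapP[i _ ->]. Qed.

Lemma contains_subseq u v w : subseq u v -> contains S u w -> contains S v w.
Proof.
by move=> uv [r ru hr]; exists r; first exact: subseq_trans uv.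
Qed.

Lemma complement_word_sub l F G :
  G \subset F -> subseq (complement_word l F) (complement_word l G).
Proof.
move=> /subsetP GF; apply: map_subseq.
have -> : [seq i <- l | i \notin F]
    = [seq i <- [seq i <- l | i \notin G] | i \notin F].
  rewrite -filter_predI; apply: eq_filter => i /=.
  by case: (boolP (i \in F)) => //= /(contra (@GF i)) ->.
exact: filter_subseq.
Qed.

Lemma position_complex_closed l w : simplicial_complex (position_complex l w).
Proof.
move=> F G GF /position_complexP[Fl hF]; apply/position_complexP; split.
  exact: subset_trans GF Fl.
exact: contains_subseq (complement_word_sub l GF) hF.
Qed.

(** A face leaves a reduced word of [w] at some positions outside it; all other positions of [l]
    form a face containing it, so a facet is exactly the complement of a reduced word. *)
Lemma position_complex_facet l w F : uniq l ->
  F \in facets (position_complex l w) ->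
  exists2 v, reduced_decomposition S v w & size v + #|F| = size l.
Proof.
move=> l_uniq; rewrite inE => /maxsetP[/position_complexP[Fl [v]]].
case/subseqP=> b size_b -> red_v maxF;
  exists (mask b (complement_word l F)) => //.
set l' := [seq i <- l | i \notin F] in size_b.
pose l'' := mask b l'; have l''l' : subseq l'' l' by apply: mask_subseq.
have l''l : subseq l'' l := subseq_trans l''l' (filter_subseq _ _).
pose F' := [set i in l | i \notin l''].
have FF' : F \subset F'.
  apply/subsetP=> i iF; rewrite inE (subsetP Fl) //=.
  by apply: contraL iF => /(mem_subseq l''l'); rewrite mem_filter => /andP[].
have defl'' : [seq i <- l | i \notin F'] = l''.
  rewrite [RHS](subseq_uniqP l_uniq l''l); apply: eq_in_filter => i il.
  by rewrite inE il negbK.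
have F'D : F' \in position_complex l w.
  apply/position_complexP; split.
    by apply/subsetP=> i; rewrite inE => /andP[].
  exists (mask b (complement_word l F)) => //.
  by rewrite /complement_word defl'' -map_mask.
have eqF := maxF F' F'D FF'.
rewrite /complement_word -map_mask size_map -/l' -/l'' -defl'' eqF.
rewrite size_filter -(count_predC (mem F) l) [RHS]addnC; congr (_ + _).
rewrite -size_filter cardE; apply: perm_size.
apply: uniq_perm; rewrite ?enum_uniq ?filter_uniq // => i.
rewrite mem_enum mem_filter /=.
by apply/idP/andP=> [iF|[]//]; rewrite (subsetP Fl).
Qed.

Lemma reduced_size u v w :
  reduced_decomposition S u w -> reduced_decomposition S v w -> size u = size v.
Proof.
by move=> [hu pu mu] [hv pv mv]; apply/eqP; rewrite eqn_leq mu // mv.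
Qed.

Lemma position_complex_pure l w : uniq l -> pure (position_complex l w).
Proof.
move=> l_uniq F G /(position_complex_facet l_uniq)[u red_u size_u].
move=> /(position_complex_facet l_uniq)[v red_v].
by rewrite -size_u (reduced_size red_u red_v) => /addnI.
Qed.

Lemma complement_word_cons i l P :
  complement_word (i :: l) P
  = if i \in P then complement_word l P else q i :: complement_word l P.
Proof. by rewrite /complement_word /=; case: (i \in P). Qed.

Lemma subset_cons i l P : i \notin P -> (P \subset i :: l) = (P \subset l).
Proof.
move=> iP; apply/subsetP/subsetP=> Pl j jP; last by rewrite inE Pl // orbT.
by have := Pl j jP; rewrite inE => /predU1P[ji|//]; rewrite -ji jP in iP.
Qed.

Lemma complement_wordU1 i l P :
  i \notin l -> complement_word l (P :|: [set i]) = complement_word l P.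
Proof.
move=> il; apply: (congr1 (map q)); apply: eq_in_filter => j jl; rewrite !inE.
by case: eqVneq jl il => [-> ->|]; rewrite ?orbF.
Qed.

Lemma link_position_complex i l w : uniq (i :: l) ->
  link [set i] (position_complex (i :: l) w) = position_complex l w.
Proof.
move=> /andP[il l_uniq]; apply/setP=> G; rewrite inE setI1_eq0.
apply/andP/idP=> [[_ /andP[iG]]|/position_complexP[Gl hG]].
  move=> /position_complexP[Gl];
    rewrite complement_word_cons in_setU in_set1 eqxx orbT.
  rewrite complement_wordU1 // => hG; apply/position_complexP; split=> //.
  apply/subsetP=> j jG; have := subsetP Gl j; rewrite !inE jG => /(_ isT).
  by case: eqVneq jG iG => [-> ->|].
have iG : i \notin G by apply: contra il => /(subsetP Gl).
have GiD : G :|: [set i] \in position_complex (i :: l) w.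
  apply/position_complexP; rewrite complement_word_cons in_setU in_set1 eqxx
    orbT.
  rewrite complement_wordU1 //; split=> //.
  by apply/subsetP=> j; rewrite !inE => /orP[/(subsetP Gl) ->|->];
    rewrite ?orbT.
by split; [apply: position_complex_closed GiD; apply: subsetUl | rewrite iG].
Qed.

Lemma del_position_complex i l w : uniq (i :: l) ->
  exists w', del [set i] (position_complex (i :: l) w) = position_complex l w'.
Proof.
move=> /andP[il l_uniq].
have [w' hw'] : exists w', forall P, contains S (q i :: complement_word l P) w
    <-> contains S (complement_word l P) w'.
  have [[v red_v]|asc] := pselect
    (exists v, reduced_decomposition S (q i :: v) w).
    exists (q i * w)%g => P; apply: contains_cons_descent red_v _ => //.
    exact: word_map.
  by exists w => P; apply: contains_cons_ascent.
exists w'; apply/setP=> G; rewrite inE setI1_eq0.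
apply/andP/idP=> [[/position_complexP[Gl hG] iG]|/position_complexP[Gl hG]].
  apply/position_complexP; rewrite -(subset_cons l iG); split=> //.
  by apply/hw'; rewrite complement_word_cons (negPf iG) in hG.
have iG : i \notin G by apply: contra il => /(subsetP Gl).
split=> //; apply/position_complexP; rewrite complement_word_cons (negPf iG).
by rewrite subset_cons //; split=> //; apply/hw'.
Qed.

Lemma position_complex_vertex_decomposable l w : uniq l ->
  position_complex l w != set0 -> vertex_decomposable (position_complex l w).
Proof.
elim: l w => [|i l IHl] w l_uniq D_neq0.
  apply: VDEmptyFace; first exact: position_complex_pure.
  have [F FD] := set0Pn _ D_neq0;
    have sub0 G : (G \in position_complex [::] w) -> G = set0.
    by case/position_complexP=> /subsetP G0 _; apply/setP=> j; rewrite inE;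
      apply/negP=> /G0.
  apply/setP=> G; rewrite in_set1; apply/idP/eqP=> [/sub0//|->].
  by rewrite -(sub0 F FD).
have [_ ul] := andP l_uniq; have [w' del_w'] := del_position_complex w l_uniq.
have sub0_closed := @position_complex_closed.
have [F FD] := set0Pn _ D_neq0.
have D'_neq0 : position_complex l w' != set0.
  apply/set0Pn; exists set0; rewrite -del_w' inE set0I eqxx andbT.
  exact: sub0_closed (sub0set F) FD.
have [iD|iD] := boolP ([set i] \in position_complex (i :: l) w).
  apply: (VDVertex _ iD); first exact: position_complex_pure.
    by rewrite del_w'; apply: IHl.
  rewrite link_position_complex //; apply: IHl => //; apply/set0Pn; exists set0.
  rewrite -(link_position_complex w l_uniq) inE set0I eqxx set0U iD !andbT.
  exact: sub0_closed (sub0set F) FD.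
(* If [i] is not a vertex, no face contains it and the complex is its own deletion. *)
suff <- : del [set i] (position_complex (i :: l) w) = position_complex
  (i :: l) w.
  by rewrite del_w'; apply: IHl.
apply/setP=> G; rewrite inE setI1_eq0 andb_idr // => GD.
by apply: contra iD => iG; apply: sub0_closed GD; rewrite sub1set.
Qed.

End PositionComplex.

Lemma subword_complexE (W : groupType) (S : W -> Prop) (m : nat)
    (Q : m.-tuple W) (w : W) :
  subword_complex S Q w = position_complex S (tnth Q) (enum 'I_m) w.
Proof.
apply/setP=> P; rewrite !inE; have -> : P \subset enum 'I_m.
  by apply/subsetP=> i _; rewrite mem_enum.
rewrite /= /subword /complement_word; congr (`[< contains S (map _ _) w >]).
by rewrite {1}/enum_mem -enumT; apply: eq_filter => i; rewrite /= !inE.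
Qed.

(** * Shellings of vertex-decomposable complexes *)

Section Shelling.
Variable T : finType.
Implicit Types (D : {set {set T}}) (E F G K : {set T}) (s : seq {set T}).

(** Local form of the shelling condition: the intersection of [F] with an earlier facet lies in a
    codimension 1 face of [F] that is itself covered by an earlier facet. *)
Definition shelling_step s F :=
  forall E, E \in s -> exists x,
    [/\ x \in F, x \notin E & exists2 K, K \in s & F :\ x \subset K].

Definition stepwise s :=
  forall i, i < size s -> shelling_step (take i s) (nth set0 s i).

Lemma stepwise_shelling D s :
  uniq s -> s =i facets D -> stepwise s -> shelling D s.
Proof.
move=> us sD step_s; split=> // i i_s Fi.
exists [set G | [exists x in Fi,
  (G == Fi :\ x) && has (fun K => G \subset K) (take i s)]].
  move=> G; rewrite inE => /existsP[x /and3P[xF /eqP-> _]]; split;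
    first exact: subD1set.
  by rewrite [RHS](cardsD1 x) xF.

apply/setP=> G; rewrite inE powersetE bigcup_seq; apply/andP/bigcupP.
  case=> /bigcupP[E Es]; rewrite powersetE => GE GF.
  have [x [xF xE [K Ks FK]]] := step_s i i_s E Es.
  exists (Fi :\ x); first by rewrite inE; apply/existsP; exists x;
    rewrite xF eqxx; apply/hasP; exists K.
  by rewrite powersetE subsetD1 GF; apply: contra xE => /(subsetP GE).
case=> E; rewrite inE => /existsP[x /and3P[xF /eqP-> /hasP[K Ks FK]]];
  rewrite powersetE => GF.
split; last exact: subset_trans GF (subD1set _ _).
by apply/bigcupP; exists K; rewrite //= powersetE (subset_trans GF).
Qed.

Lemma facetsP D F : reflect
  (F \in D /\ forall G, G \in D -> F \subset G -> G = F) (F \in facets D).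
Proof. by rewrite inE; exact: maxsetP. Qed.

Lemma facet_exists D F : F \in D -> exists2 G, G \in facets D & F \subset G.
Proof.
move=> FD; have [G maxG FG] := maxset_exists (P := mem D) FD.
by exists G; rewrite ?inE.
Qed.

Lemma in_del D v G : (G \in del [set v] D) = (G \in D) && (v \notin G).
Proof. by rewrite inE setI1_eq0. Qed.

Lemma in_link D v G : simplicial_complex D ->
  (G \in link [set v] D) = (v \notin G) && (v |: G \in D).
Proof.
move=> cD; rewrite inE setI1_eq0 setUC andb_idl // => /andP[_].
exact/cD/subsetUr.
Qed.

Lemma simplicial_del D v : simplicial_complex D ->
  simplicial_complex (del [set v] D).
Proof.
move=> cD F G GF; rewrite !in_del => /andP[FD vF].
by rewrite (cD F) //=; apply: contra vF => /(subsetP GF).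
Qed.

Lemma simplicial_link D v : simplicial_complex D ->
  simplicial_complex (link [set v] D).
Proof.
move=> cD F G GF; rewrite !in_link // => /andP[vF FD].
rewrite (cD (v |: F)) ?setUS // andbT.
by apply: contra vF => /(subsetP GF).
Qed.

Lemma facets_link D v G : simplicial_complex D -> v \notin G ->
  (G \in facets (link [set v] D)) = (v |: G \in facets D).
Proof.
move=> cD vG; apply/facetsP/facetsP; rewrite in_link ?vG //= => -[GD maxG].
  split=> // F FD; rewrite subUset sub1set => /andP[vF GF].
  rewrite -(setD1K vF); congr (_ |: _); apply: maxG.
    by rewrite in_link // setD1K // FD !inE eqxx.
  by rewrite subsetD1 GF.
split=> // F; rewrite in_link // => /andP[vF FD] GF.
by rewrite -(setU1K vF) (maxG _ FD) ?setUS // setU1K.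
Qed.

(* If every facet contains v then D is a cone, whose deletion has dimension one
   less; otherwise purity makes the facets of the deletion facets of D. *)
Lemma facets_del D v F0 : pure D -> pure (del [set v] D) ->
    F0 \in facets D -> v \notin F0 ->
  facets (del [set v] D) = [set G in facets D | v \notin G].
Proof.
move=> pD pd F0D vF0; apply/setP=> G; rewrite [in RHS]inE.
have facet_del F : F \in facets D -> v \notin F -> F \in facets (del [set v] D).
  move=> /facetsP[FD maxF] vF; apply/facetsP; rewrite in_del FD vF;
    split=> // K.
  by rewrite in_del => /andP[KD _]; apply: maxF.
apply/idP/andP=> [Gd|[]]; last exact: facet_del.
have /facetsP[] := Gd; rewrite in_del => /andP[GD vG] _; split=> //.
have [F FD GF] := facet_exists GD.
suff -> : G = F by [].
apply/eqP; rewrite eqEcard GF /= (pD _ _ FD F0D).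
by rewrite (pd _ _ Gd (facet_del _ F0D vF0)).
Qed.

Lemma vertex_decomposable_stepwise D : simplicial_complex D ->
  vertex_decomposable D -> exists s, [/\ uniq s, s =i facets D & stepwise s].
Proof.
move=> + vdD; elim: vdD => {D} [D _ -> _|D v pD vD vdd IHd vdl IHl cD].
  exists [:: set0]; split; [by [] | move=> F | by case].
  rewrite inE; apply/eqP/facetsP=> [->|[/set1P-> //]].
  by split=> [|G /set1P-> _]; rewrite ?inE.
have [sl [ul sl_facets step_l]] := IHl (simplicial_link cD).
have pd : pure (del [set v] D) by case: vdd.
(* [sd] lists the facets avoiding [v]: a shelling of the deletion, or the empty list when [D] is a
   cone with apex [v]. *)
have [sd [ud sd_facets sd_del step_d]] : exists s, [/\ uniq s,
    forall G, (G \in s) = (G \in facets D) && (v \notin G),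
    s != [::] -> forall G, G \in del [set v] D -> exists2 F, F \in s
      & G \subset F
    & stepwise s].
  have [/existsP[F0 /andP[F0D vF0]]|no_facet] :=
    boolP [exists F in facets D, v \notin F].
    have [s [us s_facets step_s]] := IHd (simplicial_del cD).
    exists s; split=> // [G|_ G Gd];
      first by rewrite s_facets (facets_del pD pd F0D vF0) inE.
    by have [F Fd GF] := facet_exists Gd; exists F; rewrite ?s_facets.
  exists [::]; split=> // G; rewrite in_nil; apply/esym/negP=> /andP[GD vG].
  by case/negP: no_facet; apply/existsP; exists G; rewrite GD.
have v_sl G : G \in sl -> v \notin G.
  by rewrite sl_facets => /facetsP[]; rewrite in_link // => /andP[].
have inj_v : {in sl &, injective (fun G => v |: G)}.
  by move=> F G /v_sl vF /v_sl vG eqFG; rewrite -(setU1K vF) eqFG setU1K.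
exists (sd ++ [seq v |: G | G <- sl]); split.
- rewrite cat_uniq ud map_inj_in_uniq // ul andbT;
  apply/hasPn=> _ /mapP[G _ ->].
  by rewrite sd_facets !inE eqxx andbF.
- move=> F; rewrite mem_cat sd_facets; have [vF|vF] := boolP (v \in F);
  last first.
    rewrite andbT; apply/orP/idP=> [[//|/mapP[G _ FE]]|]; last by left.
    by rewrite FE !inE eqxx in vF.
  rewrite andbF /= -(setD1K vF) -facets_link ?setD11 // -sl_facets.
  apply/mapP/idP=> [[G Gs eqFG]|Fs]; last by exists (F :\ v).
  rewrite -(@setU1K _ v (F :\ v)) ?setD11 // eqFG setU1K //; exact: v_sl.
move=> i; rewrite size_cat size_map take_cat nth_cat.
case: (ltnP i (size sd)) => [i_d _|d_i]; first exact: step_d.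
rewrite -ltn_subLR // => i_l E; rewrite -map_take mem_cat.
set j := i - size sd in i_l *; rewrite (nth_map set0) //.
have lj : nth set0 sl j \in sl by apply: mem_nth.
have v_lj := v_sl _ lj.
case/orP=> [Ed|/mapP[E' E'l ->]].
  (* Against a facet of the deletion, removing [v] works: what remains is a face of the deletion,
     hence inside some facet of [sd]. *)
  exists v; rewrite setU11; split=> //.
    by move: Ed; rewrite sd_facets => /andP[].
  rewrite setU1K //; have [||F Fs lF] := sd_del _ (nth set0 sl j).
  - by case: (sd) Ed.
  - move: lj; rewrite sl_facets in_del v_lj andbT => /facetsP[+ _].
    by rewrite inE => /andP[].
  by exists F; rewrite // mem_cat Fs.
(* Between two facets through [v], the vertex supplied by the shelling of the link works, with
   everything coned over [v]. *)
have [x [xl xE' [K Kl lK]]] := step_l j i_l E' E'l.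
have xv : x != v by apply: contraNneq v_lj => <-.
exists x; split; first by rewrite !inE xl orbT.
  by rewrite !inE negb_or xv.
exists (v |: K); first by rewrite mem_cat; apply/orP; right; apply: map_f.
apply/subsetP=> y; rewrite !inE => /andP[yx /predU1P[->|yl]];
  first by rewrite eqxx.
by rewrite (subsetP lK) ?orbT // !inE yx.
Qed.

Lemma vertex_decomposable_shellable D : simplicial_complex D ->
  vertex_decomposable D -> shellable D.
Proof.
move=> cD vdD; split; first by case: vdD.
have [s [us s_facets step_s]] := vertex_decomposable_stepwise cD vdD.
by exists s; apply: stepwise_shelling.
Qed.

(** This covers a word that does not contain [w]: its complex is void, which [vertex_decomposable]
    excludes. *)
Lemma void_shellable : shellable (set0 : {set {set T}}).
Proof.
have no_facet F : F \notin facets set0 by apply/facetsP; rewrite inE => -[].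
split; first by move=> F G Ff; have := no_facet F; rewrite Ff.
by exists [::]; split=> // F; rewrite in_nil; apply/esym/negbTE/no_facet.
Qed.

End Shelling.

Import GRing.Theory.
Local Open Scope ring_scope.

(** * Regular sequences and chains of prime ideals *)

Section IdealTheory.
Variable A : comPzRingType.
Implicit Types (I J P G : A -> Prop) (a b x y : A) (s : seq A).

Lemma ideal0 I : ideal I -> I 0. Proof. by case. Qed.
Lemma ideal_add I x y : ideal I -> I x -> I y -> I (x + y).
Proof. by case=> _ + _; apply. Qed.
Lemma ideal_mull I a x : ideal I -> I x -> I (a * x).
Proof. by case=> _ _; apply. Qed.
Lemma ideal_mulr I a x : ideal I -> I x -> I (x * a).
Proof. by rewrite mulrC; apply: ideal_mull. Qed.
Lemma ideal_opp I x : ideal I -> I x -> I (- x).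
Proof. by rewrite -mulN1r; apply: ideal_mull. Qed.
Lemma ideal_sub I x y : ideal I -> I x -> I y -> I (x - y).
Proof.
by move=> hI hx hy; apply: ideal_add => //; apply: ideal_opp.
Qed.
Lemma ideal_congr I x y : ideal I -> I (x - y) -> I x <-> I y.
Proof.
move=> hI hxy; split=> [hx|hy]; last by rewrite -(subrK y x); apply: ideal_add.
by rewrite -(subKr x y); apply: ideal_sub.
Qed.
Lemma ideal_sum I (T : Type) (r : seq T) (Q : pred T) (F : T -> A) : ideal I ->
  (forall i, Q i -> I (F i)) -> I (\sum_(i <- r | Q i) F i).
Proof.
by move=> hI hF; apply: big_ind => //;
  [apply: ideal0 | move=> x y; apply: ideal_add].
Qed.

Lemma ideal_gen_in G x : G x -> ideal_gen G x.
Proof. by move=> Gx I hI; apply. Qed.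

(** Quotients are handled through ideals of the fixed ring [A]: this is I + (a), and [colon I a] is
    I : a. *)
Definition adjoin I a x := exists b, I (x - b * a).
Definition colon I a x := I (x * a).

Lemma ideal_adjoin I a : ideal I -> ideal (adjoin I a).
Proof.
move=> hI; split=> [|x y [b hb] [c hc]|c x [b hb]].
- by exists 0; rewrite mul0r subr0; apply: ideal0.
- by exists (b + c); rewrite (_ : _ - _ = (x - b * a) + (y - c * a));
  [apply: ideal_add | ring].
- by exists (c * b); rewrite (_ : _ - _ = c * (x - b * a));
  [apply: ideal_mull | ring].
Qed.

Lemma sub_adjoin I a x : I x -> adjoin I a x.
Proof. by exists 0; rewrite mul0r subr0. Qed.

Lemma adjoin_gen I a : ideal I -> adjoin I a a.
Proof. by exists 1; rewrite mul1r subrr; apply: ideal0. Qed.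

Lemma adjoin_min I J a : ideal J -> (forall x, I x -> J x) -> J a ->
  forall x, adjoin I a x -> J x.
Proof.
move=> hJ IJ Ja x [b /IJ hb]; rewrite -(subrK (b * a) x).
by apply: ideal_add => //; apply: ideal_mull.
Qed.

Lemma eq_ideal I J : (forall x, I x <-> J x) -> I = J.
Proof. by move=> IJ; apply/funext=> x; apply/propext. Qed.

Lemma adjoinC I a b : ideal I -> adjoin (adjoin I a) b = adjoin (adjoin I b) a.
Proof.
move=> hI; apply: eq_ideal.
suff H c d : forall x, adjoin (adjoin I c) d x -> adjoin (adjoin I d) c x.
  by move=> x; split; apply: H.
have hd := ideal_adjoin d hI; have hJ := ideal_adjoin c hd.
apply: adjoin_min => //; last exact/sub_adjoin/adjoin_gen.
apply: adjoin_min => //; last exact: adjoin_gen.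
by move=> x Ix; apply/sub_adjoin/sub_adjoin.
Qed.

(** Regularity on A/I without asking that I + (s) be proper, so that inductions may pass through the
    unit ideal. *)
Fixpoint weakly_regular I s :=
  if s is a :: s' then
    (forall x, I (a * x) -> I x) /\ weakly_regular (adjoin I a) s'
  else True.

(** If x b = y a modulo I, then a y lies in I + (b), so y = z b modulo I for some z, and x - z a
    lies in I : b. Thus the splitting along b persists after a is adjoined. *)
Lemma colon_adjoin I a b : ideal I ->
  (forall x, adjoin I b (a * x) -> adjoin I b x) ->
  colon (adjoin I a) b = adjoin (colon I b) a.
Proof.
move=> hI reg_a; apply: eq_ideal => x; rewrite /colon; split=> [[y hy]|[c hc]].
  have [|z hz] := reg_a y.
    exists x; rewrite (_ : _ - _ = - (x * b - y * a));
      [exact: ideal_opp | ring].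
  exists z; rewrite /= (_ : _ * b = (x * b - y * a) + a * (y - z * b));
    last by ring.
  by apply: ideal_add => //; apply: ideal_mull.
by exists (c * b); rewrite (_ : _ - _ = (x - c * a) * b) //; ring.
Qed.

(* The quotients by I : b, I and I + (b) form an exact sequence
   0 -> A/(I : b) -> A/I -> A/(I + (b)) -> 0. *)
Lemma weakly_regular_split I b s : ideal I ->
  weakly_regular (colon I b) s -> weakly_regular (adjoin I b) s ->
    weakly_regular I s.
Proof.
elim: s I => [//|a s IHs] I hI /= [colon_a colon_s] [adj_a adj_s]; split.
  move=> x Iax; have [|y hy] := adj_a x; first exact: sub_adjoin.
  rewrite -(subrK (y * b) x); apply: ideal_add => //; apply: colon_a.
  rewrite /colon (_ : _ * b = a * x - a * (x - y * b)); last by ring.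
  by apply: ideal_sub => //; apply: ideal_mull.
apply: IHs; first exact: ideal_adjoin.
  by rewrite colon_adjoin.
by rewrite adjoinC.
Qed.

Lemma weakly_regular_unit I s : ideal I -> I 1 -> weakly_regular I s.
Proof.
elim: s I => [//|a s IHs] I hI I1 /=; split.
  by move=> x _; rewrite -(mulr1 x); apply: ideal_mull.
by apply: IHs; [apply: ideal_adjoin | apply: sub_adjoin].
Qed.

Lemma ideal_foldl_adjoin I s : ideal I -> ideal (foldl adjoin I s).
Proof. by elim: s I => [|a s IHs] I hI //=; apply/IHs/ideal_adjoin. Qed.

Lemma sub_foldl_adjoin I s x : I x -> foldl adjoin I s x.
Proof. by elim: s I => [|a s IHs] I hI //=; apply/IHs/sub_adjoin. Qed.

Lemma foldl_adjoin_mem I s x : ideal I -> x \in s -> foldl adjoin I s x.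
Proof.
elim: s I => [|a s IHs] I hI //=; rewrite inE => /predU1P[->|xs].
  exact/sub_foldl_adjoin/adjoin_gen.
by apply: IHs => //; apply: ideal_adjoin.
Qed.

Lemma foldl_adjoin_min I J s : ideal J -> (forall x, I x -> J x) ->
  (forall x, x \in s -> J x) -> forall x, foldl adjoin I s x -> J x.
Proof.
move=> hJ; elim: s I => [|a s IHs] I IJ sJ //=; apply: IHs.
  by apply: adjoin_min => //; apply: sJ; rewrite inE eqxx.
by move=> x xs; apply: sJ; rewrite inE xs orbT.
Qed.

Lemma ideal_zero : ideal (fun x => x = 0).
Proof.
by split=> [|_ _ -> ->|a _ ->] //; rewrite ?addr0 ?mulr0.
Qed.

Lemma ideal_gen_seq s :
  ideal_gen (fun g => g \in s) = foldl adjoin (fun x => x = 0) s.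
Proof.
apply: eq_ideal => x; split.
  move=> /(_ (foldl adjoin (fun x => x = 0) s)); apply.
    exact: ideal_foldl_adjoin ideal_zero.
  by move=> y; apply: foldl_adjoin_mem; apply: ideal_zero.
apply: foldl_adjoin_min; first exact: ideal_gen_ideal.
  by move=> _ ->; have [] := ideal_gen_ideal (fun g => g \in s).
by move=> y ys; apply: ideal_gen_in.
Qed.

Lemma weakly_regular_nth I s : weakly_regular I s <->
  forall i, (i < size s)%N -> forall x,
    foldl adjoin I (take i s) (s`_i * x) -> foldl adjoin I (take i s) x.
Proof.
elim: s I => [|a s IHs] I //=; split=> [[reg_a /IHs reg_s] [|i]|reg] //.
  exact: reg_s.
by split; [apply: (reg 0%N) | apply/IHs=> i; apply: (reg i.+1)].
Qed.

Lemma weakly_regular_rcons I s a : weakly_regular I (rcons s a) <->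
  weakly_regular I s /\ forall x, foldl adjoin I s (a * x) ->
    foldl adjoin I s x.
Proof.
elim: s I => [|b s IHs] I /=; first by split=> [[]|[_ ?]].
by rewrite IHs; split=> [[? []]|[[]]].
Qed.

Lemma regular_seqE s : regular_seq s <->
  ~ ideal_gen (fun g => g \in s) 1 /\ weakly_regular (fun x => x = 0) s.
Proof.
split=> -[s1]; rewrite ?weakly_regular_nth => reg; split=> //.
  by move=> i i_s x; rewrite -ideal_gen_seq; apply: reg.
by move=> i i_s x; rewrite ideal_gen_seq; apply: reg.
Qed.

(* Q is maximal among the ideals containing J and disjoint from the
   multiplicative set of all y * x ^+ i with y outside P. *)
Lemma prime_below_regular J P x : ideal J -> prime_ideal P ->
    (forall y, J y -> P y) -> P x -> (forall y, J (x * y) -> J y) ->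
  exists Q, [/\ prime_ideal Q, forall y, J y -> Q y & Defs.proper_sub Q P].
Proof.
move=> hJ [hP P1 primeP] JP Px reg_x.
pose M m := exists y i, ~ P y /\ m = y * x ^+ i.
have MM m1 m2 : M m1 -> M m2 -> M (m1 * m2).
  move=> [y1 [i1 [Py1 ->]]] [y2 [i2 [Py2 ->]]]; exists (y1 * y2), (i1 + i2)%N.
  by split; [case/primeP | rewrite exprD mulrACA].
pose good I := [/\ ideal I, forall y, J y -> I y & forall y, I y -> ~ M y].
(* [J] lies in [P] and [x] cancels modulo [J], so [J] avoids [M]. *)
have goodJ : good J.
  split=> // _ /[swap] -[y [i [Py ->]]] hJy; apply: Py; apply: JP.
  by elim: i hJy => [|i IHi]; rewrite ?expr0 ?mulr1 // exprS mulrCA => /reg_x.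
have [|Q [goodQ maxQ]] :=
  @classical_sets.Zorn_bigcup A (fun I => (forall y, ~ I y) \/ good I).
  move=> F Fgood totF.
  have [[I0 FI0 gI0]|noI] := pselect (exists2 I, F I & good I); last first.
    by left=> y [I FI Iy]; have [/(_ y)|gI] := Fgood I FI => //; apply: noI;
      exists I.
  have goodF I y : F I -> I y -> good I by move=> /Fgood[/(_ y)|].
  right; split; last by move=> y [I FI Iy]; have [_ _] := goodF I y FI Iy;
    apply.
    split.
    - by exists I0 => //; case: gI0 => hI0 _ _; apply: ideal0.
    - move=> y z [I FI Iy] [K FK Kz].
      have [hI _ _] := goodF _ _ FI Iy; have [hK _ _] := goodF _ _ FK Kz.
      have [IK|KI] := totF I K FI FK.
        by exists K => //; apply: ideal_add => //; apply: IK.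
      by exists I => //; apply: ideal_add => //; apply: KI.
    - move=> a y [I FI Iy]; have [hI _ _] := goodF _ _ FI Iy.
      by exists I => //; apply: ideal_mull.
  by move=> y Jy; exists I0 => //; case: gI0 => _ JI0 _; apply: JI0.
have {goodQ} [hQ JQ QM] : good Q.
  case: goodQ => // Q0; case: (maxQ J); last by right.
  by split=> [y /Q0|] // => /(_ 0 (ideal0 hJ)) /Q0.
have QP y : Q y -> P y.
  by move=> Qy; apply: contrapT => Py; apply: (QM y Qy); exists y, 0%N;
    rewrite mulr1.
(* By maximality, enlarging [Q] by an outside element makes it meet [M]; two such elements with
   product in [Q] would put an element of [M] into [Q]. *)
have meetM a : ~ Q a -> exists2 m, adjoin Q a m & M m.
  move=> Qa; apply: contrapT => noM; apply: (maxQ (adjoin Q a)).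
    by split=> [y|/(_ a (adjoin_gen _ hQ))//]; apply: sub_adjoin.
  right; split; first exact: ideal_adjoin.
    by move=> y /JQ; apply: sub_adjoin.
  by move=> y hy My; apply: noM; exists y.
exists Q; split=> //.
  split=> // [|a b Qab]; first by move=> /QP.
  have [Qa|/meetM[m1 [c hc] Mm1]] := pselect (Q a); [by left | right].
  apply: contrapT => /meetM[m2 [d hd] Mm2]; apply: (QM (m1 * m2));
    last exact: MM.
  rewrite (_ : m1 * m2 = (m1 - c * a) * m2 + c * a * (m2 - d * b) + c * d *
    (a * b)).
    by apply: ideal_add => //; [apply: ideal_add => //|];
      [apply: ideal_mulr | apply: ideal_mull | apply: ideal_mull].
  by ring.
split=> //; exists x => // Qx; apply: (QM x Qx).
by exists 1, 1%N; rewrite mul1r expr1.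
Qed.

(** The last element of the sequence gives a prime strictly inside [P] that contains [I] and the
    earlier elements; the induction continues below that prime. *)
Lemma weakly_regular_prime_chain I s P : ideal I -> prime_ideal P ->
    (forall x, I x -> P x) -> (forall x, x \in s -> P x) ->
  weakly_regular I s -> prime_chain P (size s).
Proof.
move=> hI; elim/last_ind: s P => [|s a IHs] P primeP IP sP.
  by exists (fun=> P); split=> // i; rewrite leqNgt ltn0.
move=> /weakly_regular_rcons[reg_s reg_a]; have hP : ideal P by case: primeP.
have sP' x : x \in s -> P x by move=> xs; apply: sP;
  rewrite mem_rcons inE xs orbT.
have [|||Q [primeQ JQ QP]] := prime_below_regular _ primeP _ _ reg_a.
- exact: ideal_foldl_adjoin.
- exact: foldl_adjoin_min.
- by apply: sP; rewrite mem_rcons inE eqxx.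
have [||p [p_prime p_lt p_last]] := IHs Q primeQ _ _ reg_s.
- by move=> x Ix; apply/JQ/sub_foldl_adjoin.
- by move=> x xs; apply/JQ/foldl_adjoin_mem.
rewrite size_rcons; exists (fun i => if (i <= size s)%N then p i else P).
split=> [i|i|]; last by rewrite ltnn.
  by case: (leqP i (size s)) => [/p_prime|].
rewrite ltnS => i_s; rewrite i_s; case: (ltnP i (size s)) => [/p_lt//|s_i].
by have -> : i = size s; [apply/eqP; rewrite eqn_leq i_s | rewrite p_last].
Qed.

End IdealTheory.

(** * Zariski's lemma *)

Lemma comm_rmorph (R K : comNzRingType) (f : {rmorphism R -> K}) (u : K) :
  commr_rmorph f u.
Proof. by move=> x; apply: mulrC. Qed.

(* The ring R[u], for u in K, is represented by {poly R} with its evaluation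
   morphism to K. *)
Definition poly_eval (R K : comNzRingType) (f : {rmorphism R -> K}) (u : K) :
  {rmorphism {poly R} -> K} := horner_morph (comm_rmorph f u).

Lemma poly_evalE (R K : comNzRingType) (f : {rmorphism R -> K}) (u : K) p :
  poly_eval f u p = (map_poly f p).[u].
Proof. by []. Qed.

Section Integrality.
Variables (R K : comNzRingType) (f : {rmorphism R -> K}).

Lemma integral_trans (R' : comNzRingType) (g : {rmorphism R' -> K}) x :
  (forall r, integralOver f (g r)) -> integralOver g x -> integralOver f x.
Proof.
move=> int_g [p mon_p px0];
  apply: integral_root_monic (monic_map g mon_p) px0 _.
by apply/integral_poly=> i; rewrite coef_map; apply: int_g.
Qed.

Lemma integral_poly_eval (R' : comNzRingType) (g : {rmorphism R' -> K}) u p :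
  (forall r, integralOver f (g r)) -> integralOver f u ->
  integralOver f (poly_eval g u p).
Proof.
move=> int_g int_u; rewrite poly_evalE; apply: integral_horner => //.
by apply/integral_poly=> i; rewrite coef_map; apply: int_g.
Qed.

(** Multiply a monic equation of x of degree N + 1 by (f r)^N: since x (f r) = 1, the leading term
    becomes x and every other term falls into the image of [f]. *)
Lemma integral_inverse_mem x r :
  integralOver f x -> x * f r = 1 -> exists s, x = f s.
Proof.
move=> [p mon_p /rootP px0] xr1.
case sp: (size p) => [|[|N]].
- by move: (monic_neq0 mon_p); rewrite -size_poly_eq0 sp.
- move: px0; rewrite (size1_polyC (eq_leq sp)) map_polyC hornerC.
  have -> : p`_0 = 1 by move/monicP: mon_p; rewrite lead_coefE sp.
  by rewrite /= rmorph1 => /eqP; rewrite oner_eq0.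
exists (- \sum_(i < N.+1) p`_i * r ^+ (N - i)).
have xe i : (i <= N)%N -> x ^+ i * f r ^+ N = f r ^+ (N - i).
  by move=> iN; rewrite -{1}(subnKC iN) exprD mulrA -exprMn xr1 expr1n mul1r.
have: (map_poly f p).[x] * f r ^+ N = 0 by rewrite px0 mul0r.
have lead_p : p`_N.+1 = 1 by move/monicP: mon_p; rewrite lead_coefE sp.
rewrite horner_coef size_map_poly_id0;
  last by rewrite (monicP mon_p) rmorph1 oner_eq0.
rewrite sp big_ord_recr /= coef_map lead_p /= rmorph1 mul1r mulrDl exprS -mulrA
  xe // subnn expr0 mulr1.
rewrite addrC => /eqP; rewrite addr_eq0 => /eqP ->; rewrite rmorphN;
  congr (- _).
rewrite rmorph_sum mulr_suml; apply: eq_bigr => i _.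
by rewrite rmorphM rmorphXn coef_map -mulrA xe // -ltnS.
Qed.

End Integrality.

Section Localization.
Variables (R : comNzRingType) (K : fieldType) (f : {rmorphism R -> K}).
Implicit Types (a l r : R) (x y : K).

Lemma poly_eval_inv_clear l (h : {poly R}) : f l != 0 ->
  exists a, f l ^+ (size h) * poly_eval f (f l)^-1 h = f a.
Proof.
move=> l0; exists (\sum_(i < size h) h`_i * l ^+ (size h - i)).
rewrite poly_evalE (horner_coef_wide _ (size_poly _ _)) mulr_sumr rmorph_sum.
apply: eq_bigr => i _; rewrite coef_map rmorphM rmorphXn mulrCA; congr (_ * _).
by rewrite -{1}(subnK (ltnW (ltn_ord i))) exprD exprVn mulfK // expf_neq0.
Qed.

(** [l] is the coefficient of [q] mapping to the leading coefficient of its image, since [f] may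
    kill higher ones; dividing by it makes the equation monic over R[1/l]. *)
Lemma integral_localize q x : map_poly f q != 0 -> root (map_poly f q) x ->
  exists2 l, f l != 0 & integralOver (poly_eval f (f l)^-1) x.
Proof.
move=> q0 qx0; pose l := q`_(size (map_poly f q)).-1.
have fl : f l = lead_coef (map_poly f q) by rewrite lead_coefE coef_map.
have l0 : f l != 0 by rewrite fl lead_coef_eq0.
exists l => //; apply: (@integral_root_monic _ _ _ _
  ((f l)^-1 *: map_poly f q)).
- by rewrite monicE lead_coefZ -fl mulVf.
- by rewrite rootZ ?invr_neq0.
apply/integral_poly=> i; rewrite coefZ coef_map.
suff -> : (f l)^-1 * f q`_i = poly_eval f (f l)^-1
  (q`_i *: 'X) by apply: integral_id.
by rewrite poly_evalE map_polyZ map_polyX hornerZ hornerX mulrC.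
Qed.

Lemma integral_localize_mul l a x : f l != 0 -> f a != 0 ->
  integralOver (poly_eval f (f l)^-1) x ->
    integralOver (poly_eval f (f (l * a))^-1) x.
Proof.
move=> l0 a0; apply: integral_trans => p; apply: integral_poly_eval.
  move=> r; suff -> : f r = poly_eval f
    (f (l * a))^-1 r%:P by apply: integral_id.
  by rewrite poly_evalE map_polyC hornerC.
suff -> : (f l)^-1 = poly_eval f (f (l * a))^-1 (a *: 'X) by apply: integral_id.
by rewrite poly_evalE map_polyZ map_polyX hornerZ hornerX rmorphM invfM mulrCA
  mulfV ?mulr1.
Qed.

End Localization.

(** Reversing the monic equation of [y] gives an equation of its inverse over R[1/l]. Inverting one
    more element [h] makes it monic, and clearing denominators replaces [h] by an element [a] of
    R. *)
Lemma integral_localize_inv (R : comNzRingType) (K : fieldType)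
    (f : {rmorphism R -> K}) (l : R) (y : K) : f l != 0 -> y != 0 ->
  integralOver (poly_eval f (f l)^-1) y ->
  exists2 a, f a != 0 & integralOver (poly_eval f (f (l * a))^-1) y^-1.
Proof.
move=> l0 y0 [p mon_p /rootP py0]; set g := poly_eval f _ in py0 *.
pose p' := \poly_(i < size p) p`_((size p).-1 - i).
have sp0 : (0 < size p)%N by rewrite size_poly_gt0 monic_neq0.
have p'0 : map_poly g p' != 0.
  apply/eqP => /(congr1 (fun q : {poly K} => q`_0));
    rewrite coef_map coef_poly sp0 subn0 coef0.
  by rewrite -lead_coefE (monicP mon_p) /= rmorph1 => /eqP; rewrite oner_eq0.
have p'y : root (map_poly g p') y^-1.
  apply/rootP; rewrite (@horner_coef_wide _ (size p)); last first.
    exact: leq_trans (size_poly _ _) (size_poly _ _).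
  rewrite (reindex_inj rev_ord_inj) /=.
  transitivity (y ^- (size p).-1 * (map_poly g p).[y]);
    last by rewrite py0 mulr0.
  rewrite (@horner_coef_wide _ (size p)) ?size_poly // mulr_sumr;
    apply: eq_bigr => i _.
  have ip : (i <= (size p).-1)%N by rewrite -ltnS prednK.
  have -> : (size p - i.+1 = (size p).-1 - i)%N by rewrite -{1}(prednK sp0)
    subSS.
  have lt_p : ((size p).-1 - i < size p)%N by rewrite
    -[in X in (_ < X)%N](prednK sp0) ltnS leq_subr.
  rewrite !coef_map coef_poly lt_p subKn //= mulrCA; congr (_ * _).
  by rewrite -{2}(subnK ip) exprD invfM exprVn mulfVK ?expf_neq0.
have [h h0 int_h] := integral_localize p'0 p'y.
have [a ha] := poly_eval_inv_clear h l0.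
have a0 : f a != 0 by rewrite -ha mulf_neq0 ?expf_neq0.
exists a => //; apply: integral_trans int_h => p1;
  apply: integral_poly_eval => [r|].
  by apply: integral_localize_mul => //; apply: integral_id.
have -> : (g h)^-1 = f l ^+ size h * (f a)^-1.
  by rewrite -ha invfM mulrA mulfV ?mul1r // expf_neq0.
suff -> : f l ^+ size h * (f a)^-1 = poly_eval f (f (l * a))^-1
  (l ^+ (size h).+1 *: 'X).
  exact: integral_id.
rewrite poly_evalE map_polyZ map_polyX hornerZ hornerX rmorphXn rmorphM invfM.
by rewrite exprSr -mulrA (mulrA (f l)) mulfV // mul1r.
Qed.

Inductive generated (R K : comNzRingType) (f : R -> K) (s : seq K) : K ->
  Prop :=
| GenBase r : generated f s (f r)
| GenSeq x : x \in s -> generated f s x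
| GenD x y : generated f s x -> generated f s y -> generated f s (x + y)
| GenM x y : generated f s x -> generated f s y -> generated f s (x * y).

(* If b were transcendental over R and R[b][1/y] contained 1/(1 + b y), a power
   of y would be a multiple of 1 + b y in a polynomial ring. *)
Lemma algebraic_of_integral (R : comNzRingType) (K : fieldType)
    (f : {rmorphism R -> K}) (b : K) (r : {poly R}) :
  let g := poly_eval f b in g r != 0 ->
  (forall x, integralOver (poly_eval g (g r)^-1) x) ->
  exists2 q, map_poly f q != 0 & root (map_poly f q) b.
Proof.
move=> g r0 int_g; apply: contrapT => transc.
have {}transc q : g q = 0 -> map_poly f q = 0.
  move=> gq; apply/eqP; apply: contrapT => /negP q0.
  by apply: transc; exists q => //; apply/rootP.
pose d := 1 + 'X * r.
have fr0 : map_poly f r != 0.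
  by apply: contraNneq r0 => fr; rewrite /g poly_evalE fr horner0.
have fd : map_poly f d = 1 + 'X * map_poly f r.
  by rewrite rmorphD rmorph1 rmorphM /= map_polyX.
have size_d : (1 < size (map_poly f d))%N.
  rewrite fd addrC size_polyDl mulrC size_mulX // ?size_poly1 ltnS
    size_poly_gt0 //.
have gd0 : g d != 0.
  by apply/negP=> /eqP/transc fd0; rewrite fd0 size_poly0 in size_d.
have [|h hh] := @integral_inverse_mem _ _ (poly_eval g (g r)^-1) (g d)^-1 d%:P
  (int_g _).
  by rewrite (poly_evalE g) map_polyC hornerC mulVf.
have [a ha] := poly_eval_inv_clear h r0.
have /transc : g (r ^+ size h - d * a) = 0.
  by rewrite rmorphB rmorphM rmorphXn -ha -hh mulrCA mulfV // mulr1 subrr.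
rewrite rmorphB rmorphM rmorphXn /= => /eqP; rewrite subr_eq0 => /eqP dvd_d.
have: map_poly f d %| map_poly f r ^+ size h by rewrite dvd_d dvdp_mulr.
have cop : coprimep (map_poly f d) (map_poly f r ^+ size h).
  by apply: coprimep_expr; rewrite fd addrC coprimep_sym coprimep_addl_mul
    coprimep1.
rewrite -(mul1r (_ ^+ _)) Gauss_dvdpl // dvdp1 => /eqP size1.
by rewrite size1 in size_d.
Qed.

(** Induction on the generators, with the base enlarged to R[b]: K is integral over R[b][1/r]. Then
    b is algebraic over R, and inverting a suitable l a in R makes both b and 1/r integral. *)
Lemma integral_of_generated (R : comNzRingType) (K : fieldType)
    (f : {rmorphism R -> K}) (s : seq K) :
  (forall x, generated f s x) ->
  exists2 l, f l != 0 & forall x, integralOver (poly_eval f (f l)^-1) x.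
Proof.
elim: s R f => [|b s IHs] R f gen_s.
  exists 1; first by rewrite rmorph1 oner_eq0.
  move=> x; have [r ->] : exists r, x = f r.
    elim: (gen_s x) => [r|//|_ _ _ [r ->] _ [r' ->]|_ _ _ [r ->] _ [r' ->]].
    - by exists r.
    - by exists (r + r'); rewrite rmorphD.
    - by exists (r * r'); rewrite rmorphM.
  suff -> : f r = poly_eval f (f 1)^-1 r%:P by apply: integral_id.
  by rewrite poly_evalE map_polyC hornerC.
have [|r r0 int_r] := IHs _ (poly_eval f b).
  move=> x; elim: (gen_s x) => [r|y|y z _ hy _ hz|y z _ hy _ hz].
  - by have := GenBase (poly_eval f b) s r%:P;
    rewrite poly_evalE map_polyC hornerC.
  - rewrite inE => /predU1P[->|]; last exact: GenSeq.
    by have := GenBase (poly_eval f b) s 'X;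
      rewrite poly_evalE map_polyX hornerX.
  - exact: GenD.
  - exact: GenM.
have [q q0 qb0] := algebraic_of_integral r0 int_r.
have [l l0 int_b] := integral_localize q0 qb0.
have int_f u v : integralOver (poly_eval f u) (f v).
  suff -> : f v = poly_eval f u v%:P by apply: integral_id.
  by rewrite poly_evalE map_polyC hornerC.
have [|a a0 int_a] := integral_localize_inv l0 r0.
  by apply: integral_poly_eval.
exists (l * a); first by rewrite rmorphM mulf_neq0.
move=> x; apply: integral_trans (int_r x) => p;
  apply: integral_poly_eval => // h.
by apply: integral_poly_eval => //; apply: integral_localize_mul.
Qed.

(** Over a field, the inverse of [f l] already lies in the image of [f]. *)
Theorem zariski_lemma (k K : fieldType) (f : {rmorphism k -> K}) (s : seq K) :
  (forall x, generated f s x) -> forall x, integralOver f x.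
Proof.
move=> gen_s x; have [l l0 int_l] := integral_of_generated gen_s.
apply: integral_trans (int_l x) => p; rewrite -fmorphV.
suff -> : poly_eval f (f l^-1) p = f p.[l^-1] by apply: integral_id.
by rewrite poly_evalE horner_map.
Qed.

Local Open Scope quotient_scope.

(** * Quotient maps and residue fields *)

Section QuotientMorphism.
Variables (A : comPzRingType) (G : A -> Prop).

Definition quot_pi (x : A) : quot_ring G := \pi_(quot_ring G) x.

Lemma quot_pi_is_zmod_morphism : zmod_morphism quot_pi.
Proof. by move=> x y; rewrite /quot_pi -pi_oppr -pi_addr. Qed.

Lemma quot_pi_is_monoid_morphism : monoid_morphism quot_pi.
Proof. by split=> // x y; rewrite /quot_pi -quot_piM. Qed.

HB.instance Definition _ := GRing.isZmodMorphism.Build A (quot_ring G) quot_pi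
  quot_pi_is_zmod_morphism.
HB.instance Definition _ := GRing.isMonoidMorphism.Build A (quot_ring G) quot_pi
  quot_pi_is_monoid_morphism.

Lemma quot_pi_surj y : exists x, y = quot_pi x.
Proof. by exists (repr y); rewrite /quot_pi reprK. Qed.

Lemma quot_pi_eq0 x : quot_pi x = 0 <-> ideal_gen G x.
Proof.
have := quot_eqE G x 0; rewrite subr0 -/(quot_pi x) -/(quot_pi 0) rmorph0.
by move=> eq0; split=> [x0|/asboolP Gx];
  [apply/asboolP; move: eq0; rewrite x0 eqxx|apply/eqP; rewrite eq0].
Qed.

End QuotientMorphism.

Section ResidueField.
Variables (A : comPzRingType) (M : A -> Prop).

(** The proof [hM] is a parameter of the type so that the field structure can be attached to it as
    an instance. *)
Definition residue_field (hM : maximal_ideal M) : Type := quot_ring M.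

Variable hM : maximal_ideal M.

HB.instance Definition _ := GRing.ComPzRing.on (residue_field hM).

Lemma ideal_gen_id I : ideal (A := A) I -> ideal_gen I = I.
Proof.
move=> hI; apply: eq_ideal => x; split; last exact: ideal_gen_in.
by apply.
Qed.

Definition residue (x : A) : residue_field hM := quot_pi M x.

Lemma residue_eq0 x : residue x = 0 <-> M x.
Proof.
by have [hI _ _] := hM; rewrite -[X in _ <-> X x]ideal_gen_id //;
  apply: quot_pi_eq0.
Qed.

Lemma residue_is_zmod_morphism : zmod_morphism residue.
Proof. exact: quot_pi_is_zmod_morphism. Qed.

Lemma residue_is_monoid_morphism : monoid_morphism residue.
Proof. exact: quot_pi_is_monoid_morphism. Qed.

HB.instance Definition _ :=
  GRing.isZmodMorphism.Build A (residue_field hM) residue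
  residue_is_zmod_morphism.
HB.instance Definition _ :=
  GRing.isMonoidMorphism.Build A (residue_field hM) residue
  residue_is_monoid_morphism.

Lemma residue_surj y : exists x, y = residue x. Proof. exact: quot_pi_surj. Qed.

Lemma residue_field_nonzero : (1 : residue_field hM) != 0.
Proof.
have [_ M1 _] := hM; apply/eqP=> K1; apply/M1/residue_eq0.
by rewrite rmorph1.
Qed.

HB.instance Definition _ := GRing.PzSemiRing_isNonZero.Build (residue_field hM)
  residue_field_nonzero.

Lemma residue_field_inv (y : residue_field hM) : exists z, y <> 0 -> z * y = 1.
Proof.
have [->|/eqP y0] := eqVneq y 0; first by by exists 0.
have [x yx] := residue_surj y; have [hI M1 maxM] := hM.
have [[b hb]|no1] := pselect (adjoin M x 1).
  exists (residue b) => _; apply/esym/eqP;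
    rewrite yx -subr_eq0 -(rmorph1 (residue)) -rmorphM -rmorphB.
  exact/eqP/residue_eq0.
case: y0; rewrite yx; apply/residue_eq0.
apply: (maxM (adjoin M x)) => //; first exact: ideal_adjoin.
  by move=> z; apply: sub_adjoin.
exact: adjoin_gen.
Qed.

Definition residue_inv (y : residue_field hM) : residue_field hM :=
  if y == 0 then 0 else sval (cid (residue_field_inv y)).

Lemma residue_mulVf y : y != 0 -> residue_inv y * y = 1.
Proof.
move=> y0; rewrite /residue_inv (negPf y0).
exact: (svalP (cid (residue_field_inv y)) (elimN eqP y0)).
Qed.

Lemma residue_inv0 : residue_inv 0 = 0.
Proof. by rewrite /residue_inv eqxx. Qed.

HB.instance Definition _ := GRing.ComNzRing_isField.Build (residue_field hM)
  residue_mulVf residue_inv0.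

End ResidueField.

Lemma maximal_ideal_prime (A : comPzRingType) (M : A -> Prop) :
  maximal_ideal M -> prime_ideal M.
Proof.
move=> hM; have [hI M1 _] := hM; split=> // x y /(residue_eq0 hM).
rewrite rmorphM => /eqP; rewrite mulf_eq0 => /orP[] /eqP/residue_eq0;
  by [left|right].
Qed.

Lemma mpoly_ring_ind (R : comNzRingType) (n : nat) (P : {mpoly R[n]} -> Prop) :
  (forall c, P c%:MP) -> (forall i, P 'X_i) ->
  (forall p q, P p -> P q -> P (p + q)) ->
    (forall p q, P p -> P q -> P (p * q)) ->
  forall p, P p.
Proof.
move=> PC PX PD PM p; rewrite [p]mpolyE; apply: (big_ind P) => [|//|m _].
  by rewrite -mpolyC0.
rewrite -mul_mpolyC; apply: (PM) => //; rewrite mpolyXE_id;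
  apply: (big_ind P) => [||i _].
- by rewrite -mpolyC1.
- exact: PM.
by move: (m i) => e; elim: e => [|e IHe]; rewrite ?expr0 -?mpolyC1 // exprS;
  apply: PM.
Qed.

(** The residue field of [M] is generated over k by the classes of the variables, so the class of
    [p] is integral over k by Zariski's lemma. *)
Lemma maximal_ideal_monic (k : fieldType) (n : nat) (M : {mpoly k[n]} -> Prop)
    (p : {mpoly k[n]}) : maximal_ideal M ->
  exists2 q : {poly k}, q \is monic & M (map_poly (@mpolyC n k) q).[p].
Proof.
move=> hM; pose f : {rmorphism k -> residue_field hM} :=
  residue hM \o @mpolyC n k.
pose s := [seq residue hM 'X_i | i <- enum 'I_n].
have gen_s y : generated f s y.
  have [x ->] := residue_surj y.
  elim/mpoly_ring_ind: x => [c|i|x z hx hz|x z hx hz].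
  - exact: (GenBase f).
  - by apply: GenSeq; apply: map_f; rewrite mem_enum.
  - by rewrite rmorphD; apply: GenD.
  - by rewrite rmorphM; apply: GenM.
have [q mon_q /rootP qp] := zariski_lemma gen_s (residue hM p).
by exists q => //; apply/(residue_eq0 hM); rewrite -horner_map -map_poly_comp.
Qed.

(** * Hilbert's basis theorem *)

Section Noetherian.

Lemma ideal_preim (A B : comPzRingType) (f : {rmorphism A -> B})
  (I : B -> Prop) :
  ideal I -> ideal (fun x => I (f x)).
Proof.
move=> hI; split=> [|x y hx hy|a x hx].
- by rewrite rmorph0; apply: ideal0.
- by rewrite rmorphD; apply: ideal_add.
- by rewrite rmorphM; apply: ideal_mull.
Qed.

Lemma noetherian_surj (A B : comPzRingType) (f : {rmorphism A -> B}) :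
  (forall y, exists x, y = f x) -> noetherian A -> noetherian B.
Proof.
move=> f_surj noethA I hI.
have [s hs] := noethA _ (ideal_preim f hI).
have s_gen (x : A) : x \in s -> I (f x) by move=> xs; apply: (hs x).2;
  exact: ideal_gen_in.
exists (map f s) => y; split=> [|Iy].
  have [x ->] := f_surj y; move=>
    /hs /(_ (fun x => ideal_gen (fun g => g \in map f s) (f x))).
  apply; first exact/ideal_preim/ideal_gen_ideal.
  by move=> g gs; apply: ideal_gen_in; apply: map_f.
by apply: (Iy I) => // _ /mapP[x xs ->]; apply: s_gen.
Qed.

Lemma noetherian_field (k : fieldType) : noetherian k.
Proof.
move=> I hI; have [[a Ia a0]|no] := pselect (exists2 a, I a & a != 0).
  exists [:: 1] => x; split=> _.
    by move=> J hJ /(_ 1 (mem_head _ _)) J1; rewrite -(mulr1 x);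
      apply: ideal_mull.
  by rewrite -(mulfVK a0 x); apply: ideal_mull.
exists [::] => x; split=> [Ix|/(_ I hI)]; last by apply.
suff -> : x = 0 by move=> J hJ _; apply: ideal0.
by apply/eqP; apply: contrapT => /negP x0; apply: no; exists x.
Qed.

Section HilbertBasis.
Variable R : comNzRingType.
Implicit Types (I J : {poly R} -> Prop) (s : seq {poly R}).

Definition lead_ideal I i (a : R) :=
  exists p, [/\ I p, (size p <= i.+1)%N & p`_i = a].

Lemma ideal_lead_ideal I i : ideal I -> ideal (lead_ideal I i).
Proof.
move=> hI; split=> [|_ _ [p [Ip sp <-]] [q [Iq sq <-]]|a _ [p [Ip sp <-]]].
- by exists 0; rewrite size_poly0 coef0; split=> //; apply: ideal0.
- exists (p + q); rewrite coefD; split=> //; first exact: ideal_add.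
  by rewrite (leq_trans (size_polyD _ _)) // geq_max sp.
- exists (a%:P * p); rewrite coefCM; split=> //; first exact: ideal_mull.
  by rewrite mul_polyC (leq_trans (size_scale_leq _ _)).
Qed.

Lemma lead_idealS I i j : ideal I -> (i <= j)%N ->
  forall a, lead_ideal I i a -> lead_ideal I j a.
Proof.
move=> hI ij a [p [Ip sp <-]]; exists ('X^(j - i) * p); split.
- exact: ideal_mull.
- rewrite (leq_trans (size_polyMleq _ _)) // size_polyXn /=.
  by rewrite (leq_trans (leq_add (leqnn _) sp)) // addnS subnK.
- by rewrite coefXnM ltnNge leq_subr /= subKn.
Qed.

(** Descent on the size: subtracting a member of [J] with the same degree bound and top coefficient
    leaves a shorter member of [I]. *)
Lemma sub_of_lead_ideal I J : ideal I -> ideal J -> (forall p, J p -> I p) ->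
  (forall i a, lead_ideal I i a -> lead_ideal J i a) -> forall p, I p -> J p.
Proof.
move=> hI hJ JI lead_IJ p; have [n] := ubnP (size p).
elim: n p => // n IHn p sp Ip.
have [->|p0] := eqVneq p 0; first exact: ideal0.
have sp0 : (0 < size p)%N by rewrite size_poly_gt0.
have [|g [Jg sg g_lead]] := lead_IJ (size p).-1 p`_(size p).-1.
  by exists p; rewrite prednK.
rewrite -(subrK g p); apply: ideal_add => //; apply: IHn;
  last exact: ideal_sub (JI _ Jg).
apply: leq_trans (_ : size p <= n)%N; last by rewrite -ltnS.
rewrite -[in X in (_ < X)%N](prednK sp0) ltnS; apply/leq_sizeP => j.
rewrite leq_eqVlt => /predU1P[<-|lt_j]; first by rewrite coefB g_lead subrr.
have le_j : (size p <= j)%N by rewrite -(prednK sp0).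
by rewrite coefB !nth_default ?subrr // (leq_trans sg) // prednK.
Qed.

Lemma hilbert_basis : noetherian R -> noetherian {poly R}.
Proof.
move=> noethR I hI; have hL i := ideal_lead_ideal i hI.
(* The ideals of leading coefficients increase with the degree, so their union is an ideal; the
   chain is constant from a degree [N] that captures its finitely many generators. *)
have [N hN] : exists N, forall i a, lead_ideal I i a -> lead_ideal I N a.
  have [|t ht] := noethR (fun a => exists i, lead_ideal I i a).
    split=> [|x y [i hx] [j hy]|a x [i hx]].
    - by exists 0%N; apply: ideal0.
    - exists (maxn i j); apply: ideal_add => //.
        exact: lead_idealS (leq_maxl _ _) _ hx.
      exact: lead_idealS (leq_maxr _ _) _ hy.
    - by exists i; apply: ideal_mull.
  have [N tN] : exists N, forall a, a \in t -> lead_ideal I N a.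
    have : forall a, a \in t -> exists i, lead_ideal I i a.
      by move=> a ta; apply: (ht a).2; exact: ideal_gen_in.
    elim: (t) => [_|a u IHu hu]; first by exists 0%N.
    have [N hN] := IHu (fun b bu => hu b (mem_behead (s := a :: u) bu)).
    have [M hM] := hu a (mem_head _ _).
    exists (maxn M N) => b; rewrite inE => /predU1P[->|/hN hb].
      exact: lead_idealS (leq_maxl _ _) _ hM.
    exact: lead_idealS (leq_maxr _ _) _ hb.
  exists N => i a ha; have /ht : exists i, lead_ideal I i a by exists i.
  by apply.
have gen_lead i : exists2 s : seq {poly R}, (forall p, p \in s -> I p) &
    forall a, lead_ideal I i a -> lead_ideal (ideal_gen (fun g => g \in s)) i a.
  have [t ht] := noethR _ (hL i).
  have [s sI ts] : exists2 s : seq {poly R}, (forall p, p \in s -> I p)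
    & forall a : R, a \in t ->
      lead_ideal (ideal_gen (fun g => g \in s)) i a.
    have : forall a, a \in t -> lead_ideal I i a by move=> a ta;
      apply: (ht a).2; exact: ideal_gen_in.
    elim: (t) => [_|a u IHu hu]; first by exists [::].
    have [s sI us] := IHu (fun b bu => hu b (mem_behead (s := a :: u) bu)).
    have [p [Ip sp pa]] := hu a (mem_head _ _).
    exists (p :: s) => [q|b]; first by rewrite inE => /predU1P[->|/sI].
    rewrite inE => /predU1P[->|/us[q [gq sq qb]]].
      by exists p; split=> //; apply: ideal_gen_in; rewrite inE eqxx.
    exists q; split=> // J hJ sJ; apply: gq => // g gs.
    by apply: sJ; rewrite inE gs orbT.
  exists s => // a /ht /(_ (lead_ideal (ideal_gen (fun g => g \in s)) i));
    apply=> //.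
  exact/ideal_lead_ideal/ideal_gen_ideal.
(* Generators for the degrees up to [N] suffice, as leading coefficients in higher degrees already
   occur in degree [N]. *)
have [s sI lead_s] : exists2 s : seq {poly R}, (forall p, p \in s -> I p)
  & forall i, (i <= N)%N ->
    forall a, lead_ideal I i a -> lead_ideal (ideal_gen (fun g => g \in s)) i a.
  elim: (N) => [|n [s sI IHn]].
    by have [s sI hs] := gen_lead 0%N; exists s => // i;
      rewrite leqn0 => /eqP->.
  have [t tI ht] := gen_lead n.+1.
  have mono u v (i : nat) a : {subset u <= v} ->
      lead_ideal (ideal_gen (fun g => g \in u)) i a ->
      lead_ideal (ideal_gen (fun g => g \in v)) i a.
    move=> uv [p [gp sp pa]]; exists p; split=> // J hJ vJ.
    by apply: gp => // g /uv; apply: vJ.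
  exists (s ++ t) => [p|i]; first by rewrite mem_cat => /orP[/sI|/tI].
  rewrite leq_eqVlt ltnS => /predU1P[->|le_i] a ha.
    by apply: mono (ht a ha) => g gt; rewrite mem_cat gt orbT.
  by apply: mono (IHn i le_i a ha) => g gs; rewrite mem_cat gs.
have sub_gen p : ideal_gen (fun g => g \in s) p -> I p by apply.
exists s => p; split=> [|/sub_gen//].
apply: sub_of_lead_ideal => // [|i a ha]; first exact: ideal_gen_ideal.
have [iN|/ltnW Ni] := leqP i N; first exact: lead_s.
apply: lead_idealS Ni _ _; first exact: ideal_gen_ideal.
by apply: lead_s => //; apply: hN ha.
Qed.

End HilbertBasis.

(** The ring in n + 1 variables is the image of a univariate polynomial ring over the ring in n
    variables, the indeterminate going to the last variable. *)
Lemma noetherian_mpoly (k : fieldType) (n : nat) : noetherian {mpoly k[n]}.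
Proof.
elim: n => [|n IHn].
  apply: (noetherian_surj (f := @mpolyC 0 k) _ (@noetherian_field k)) => p.
  exists p@_0; apply/mpolyP=> m; rewrite mcoeffC.
  by have -> : m = 0%MM; [apply/mnmP=> -[] | rewrite eqxx mulr1].
apply: (noetherian_surj (f := poly_eval (@mwiden n k) 'X_ord_max) _
  (hilbert_basis IHn)) => p.
elim/mpoly_ring_ind: p => [c|i|p q [p' ->] [q' ->]|p q [p' ->] [q' ->]].
- by exists (c%:MP)%:P; rewrite poly_evalE map_polyC hornerC /= mwidenC.
- case: (unliftP ord_max i) => [j ->|->]; last first.
    by exists 'X; rewrite poly_evalE map_polyX hornerX.
  exists ('X_j)%:P; rewrite poly_evalE map_polyC hornerC /= mwidenX mnmwiden1.
  suff -> : lift ord_max j = widen_ord (leqnSn n) j by [].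
  by apply: val_inj; rewrite /= /bump leqNgt ltn_ord.
- by exists (p' + q'); rewrite rmorphD.
- by exists (p' * q'); rewrite rmorphM.
Qed.

End Noetherian.

(** * Regular sequences on face rings *)

Section FaceIdeal.
Variables (k : fieldType) (n : nat).
Implicit Types (D : {set {set 'I_n}}) (F G R : {set 'I_n}) (p : {mpoly k[n]}).
Implicit Types (m : 'X_{1..n}).

Definition mnm_support m : {set 'I_n} := [set i | m i != 0%N].

Lemma mnm_supportD m m' :
  mnm_support (m + m')%MM = mnm_support m :|: mnm_support m'.
Proof. by apply/setP=> i; rewrite !inE mnmDE addn_eq0 negb_and. Qed.

Lemma mnm_support_mesym1 F : mnm_support (mesym1 F) = F.
Proof. by apply/setP=> i; rewrite inE mnmE; case: (i \in F). Qed.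

Lemma mesym1_le F m : (mesym1 F <= m)%MM = (F \subset mnm_support m).
Proof.
apply/mnm_lepP/subsetP=> [le_m i iF|sub_m i].
  by have := le_m i; rewrite mnmE iF inE lt0n.
by rewrite mnmE; case: (boolP (i \in F)) => // /sub_m; rewrite inE lt0n.
Qed.

Lemma prod_mpolyX F : \prod_(i in F) 'X_i = 'X_[mesym1 F] :> {mpoly k[n]}.
Proof.
rewrite mprodXE; congr 'X_[_]; apply/mnmP=> i; rewrite mnmE mnm_sumE.
rewrite big_mkcond (bigD1 i) //= mnm1E eqxx big1 ?addn0; first by case: ifP.
by move=> j ji; case: ifP => // _; rewrite mnm1E (negPf ji).
Qed.

(** For a simplicial complex this is the Stanley-Reisner ideal, described by coefficients; for
    [powerset F] the quotient is the polynomial ring in the variables of [F]. *)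
Definition face_ideal D p := forall m, mnm_support m \in D -> p@_m = 0.

Lemma ideal_face_ideal D : simplicial_complex D -> ideal (face_ideal D).
Proof.
move=> cD; split=> [m _|p q hp hq m mD|a p hp m mD]; first by rewrite mcoeff0.
  by rewrite mcoeffD hp // hq // addr0.
apply: memN_msupp_eq0; apply/negP=>
  /msuppM_le/allpairsP[[m1 m2] /= [_ m2p m_def]].
move: m2p; rewrite mcoeff_msupp hp ?eqxx //; apply: cD mD.
by rewrite m_def mnm_supportD subsetUr.
Qed.

Lemma ideal_mpolyX (I : {mpoly k[n]} -> Prop) p : ideal I ->
  (forall m, p@_m != 0 -> I 'X_[m]) -> I p.
Proof.
move=> hI Ip; rewrite [p]mpolyE big_seq_cond; apply: ideal_sum => // m.
rewrite andbT mcoeff_msupp => /Ip; rewrite -mul_mpolyC; exact: ideal_mull.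
Qed.

Lemma face_idealX D m : mnm_support m \notin D -> face_ideal D 'X_[m].
Proof.
move=> mD m' m'D; rewrite mcoeffX; case: eqP => // mm'.
by rewrite mm' m'D in mD.
Qed.

Lemma stanley_reisner_idealE D : simplicial_complex D ->
  ideal_gen (@nonface_monomial k n D) = face_ideal D.
Proof.
move=> cD; apply: eq_ideal => p; split=> [|hp I hI DI].
  apply; first exact: ideal_face_ideal.
  move=> _ [F FD ->]; rewrite prod_mpolyX; apply: face_idealX.
  by rewrite mnm_support_mesym1.
apply: ideal_mpolyX => // m pm.
have mD : mnm_support m \notin D by apply: contraNN pm => /hp ->.
have le_m : (mesym1 (mnm_support m) <= m)%MM by rewrite mesym1_le.
rewrite -(submK le_m) mpolyXD; apply: ideal_mull => //; apply: DI.
by exists (mnm_support m); rewrite ?prod_mpolyX.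
Qed.

(* Split along the monomial of R: the colon ideal is that of the simplex F and
   the sum is that of D. *)
Lemma weakly_regular_shelling_step D F R s : simplicial_complex D ->
    R \subset F -> (forall G, G \subset F -> (G \in D) = ~~ (R \subset G)) ->
    weakly_regular (face_ideal D) s ->
    weakly_regular (face_ideal (powerset F)) s ->
  weakly_regular (face_ideal (D :|: powerset F)) s.
Proof.
move=> cD RF DF reg_D reg_F.
have cF : simplicial_complex (powerset F).
  by move=> G H HG; rewrite !powersetE; apply: subset_trans.
have cU : simplicial_complex (D :|: powerset F).
  by move=> G H HG; rewrite !inE => /orP[/(cD _ _ HG)->|/(subset_trans HG)->];
    rewrite ?orbT.
have hU := ideal_face_ideal cU.
have RD : R \notin D by rewrite DF // subxx.
apply: (@weakly_regular_split _ _ 'X_[mesym1 R]) => //.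
  suff -> : colon (face_ideal (D :|: powerset F)) 'X_[mesym1 R] = face_ideal
    (powerset F) by [].
  apply: eq_ideal => p; split=> hp m.
    rewrite powersetE => mF; rewrite -(mcoeffMX p (mesym1 R)); apply: hp.
    by rewrite mnm_supportD mnm_support_mesym1 !inE subUset RF mF orbT.
  rewrite /= => mU; apply: memN_msupp_eq0.
  rewrite (perm_mem (msuppMX _ _)); apply/negP=> /mapP[m' m'p m_def].
  move: mU; rewrite m_def mnm_supportD mnm_support_mesym1 !inE subUset =>
    /orP[RmD|/andP[_ mF]].
    by case/negP: RD; apply: cD RmD; apply: subsetUl.
  by move: m'p; rewrite mcoeff_msupp hp ?eqxx // powersetE.
suff -> : adjoin (face_ideal (D :|: powerset F)) 'X_[mesym1 R]
  = face_ideal D by [].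
apply: eq_ideal => p; split.
  apply: adjoin_min; first exact: ideal_face_ideal.
    by move=> q hq m mD; apply: hq; rewrite inE mD.
  by apply: face_idealX; rewrite mnm_support_mesym1.
move=> hp; apply: ideal_mpolyX => [|m pm]; first exact: ideal_adjoin.
have mD : mnm_support m \notin D by apply: contraNN pm => /hp ->.
have [mF|mF] := boolP (mnm_support m \subset F); last first.
  by apply/sub_adjoin/face_idealX; rewrite !inE negb_or mD.
have le_m : (mesym1 R <= m)%MM by rewrite mesym1_le -[_ \subset _]negbK -DF.
rewrite -(submK le_m) mpolyXD; apply: ideal_mull; first exact: ideal_adjoin.
exact: adjoin_gen.
Qed.

Lemma weakly_regular_shelling D sh s : simplicial_complex D -> shelling D sh ->
  (forall F, F \in facets D -> weakly_regular (face_ideal (powerset F)) s) ->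
  weakly_regular (face_ideal D) s.
Proof.
move=> cD [sh_uniq sh_facets sh_step] reg_F.
pose U i := \bigcup_(F <- take i sh) powerset F.
have cU i : simplicial_complex (U i).
  move=> G H HG; rewrite /U !bigcup_seq => /bigcupP[F Fs];
    rewrite powersetE => GF.
  by apply/bigcupP; exists F; rewrite ?powersetE // (subset_trans HG).
have -> : D = U (size sh).
  rewrite /U take_size bigcup_seq; apply/setP=> G;
    apply/idP/bigcupP=> [GD|[F Fs]].
    by have [F FD GF] := facet_exists GD; exists F;
      rewrite ?sh_facets ?powersetE.
  rewrite powersetE => GF; apply: cD GF _.
  by move: Fs; rewrite sh_facets => /facetsP[].
have: (size sh <= size sh)%N by [].
elim: {1 3}(size sh) => [_|i IHi i_s].
  (* The empty union is the void complex, whose face ideal is the whole ring. *)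
  apply: weakly_regular_unit; first exact: ideal_face_ideal.
  by move=> m; rewrite /U take0 big_nil inE.
have -> : U i.+1 = U i :|: powerset (nth set0 sh i).
  by rewrite /U (take_nth set0) // -cats1 big_cat big_seq1.
have Fi : nth set0 sh i \in facets D by rewrite -sh_facets mem_nth.
have [C Csub Ceq] := sh_step i i_s.
(* [R] is the restriction face: a face of the new facet is new exactly when it contains [R], that
   is, when it lies in no member of [C]. *)
pose R := [set x in nth set0 sh i | nth set0 sh i :\ x \in C].
apply: (@weakly_regular_shelling_step _ _ R) => //.
- by apply/subsetP=> x; rewrite inE => /andP[].
- move=> G GF.
  have -> : (G \in U i) = (G \in (U i :&: powerset (nth set0 sh i))).
    by rewrite inE powersetE GF andbT.
  rewrite Ceq; apply/bigcupP/subsetPn=> [[E EC]|[x]].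
    rewrite powersetE => GE; have [EF cardE] := Csub E EC.
    have [x xF xE] : exists2 x, x \in nth set0 sh i & x \notin E.
      by apply/subsetPn; apply/negP=> /subset_leq_card; rewrite -cardE ltnn.
    have eqE : E = nth set0 sh i :\ x.
      apply/eqP; rewrite eqEcard subsetD1 EF xE /=.
      by rewrite -ltnS cardE (cardsD1 x (nth set0 sh i)) xF.
    exists x; first by rewrite inE xF -eqE.
    by apply: contra xE => /(subsetP GE).
  rewrite inE => /andP[xF xC] xG; exists (nth set0 sh i :\ x) => //.
  by rewrite powersetE subsetD1 GF.
- by apply: IHi; apply: ltnW.
- exact: reg_F.
Qed.

End FaceIdeal.

(** * Elementary symmetric functions as regular sequences *)

Section ElementarySymmetric.
Variables (A : comPzRingType) (n : nat) (f : 'I_n -> A).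
Implicit Types (B C : {set 'I_n}).

Definition esym d := \sum_(C : {set 'I_n} | #|C| == d) \prod_(i in C) f i.

(** The order e_d, .., e_1 drives the induction: modulo the [f i] outside a set of d indices, e_d is
    a single product, and killing one of its factors leaves d - 1 indices for the rest. *)
Fixpoint esym_seq d := if d is d'.+1 then esym d :: esym_seq d' else [::].

Lemma size_esym_seq d : size (esym_seq d) = d.
Proof. by elim: d => //= d ->. Qed.

Lemma esym_seq_ideal (I : A -> Prop) d x :
  ideal I -> (forall i, I (f i)) -> x \in esym_seq d -> I x.
Proof.
move=> hI If; elim: d => //= d IHd; rewrite inE => /predU1P[->|//].
apply: ideal_sum => // C /eqP cardC.
have [i iC] : exists i, i \in C by apply/card_gt0P; rewrite cardC.
by rewrite (bigD1 i) //=; apply: ideal_mulr.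
Qed.

(** A set of [#|B|] indices other than [B] contains an index outside [B], so its product lies in
    [I]. *)
Lemma esym_congr (I : A -> Prop) B : ideal I ->
  (forall i, i \notin B -> I (f i)) ->
  I (esym #|B| - \prod_(i in B) f i).
Proof.
move=> hI If; rewrite /esym (bigD1 B) //= addrAC subrr add0r;
  apply: ideal_sum => // C.
move=> /andP[/eqP cardC CB].
have [i iC iB] : exists2 i, i \in C & i \notin B.
  by apply/subsetPn; apply: contraNN CB => CB; rewrite eqEcard CB cardC leqnn.
by rewrite (bigD1 i) //=; apply: ideal_mulr => //; apply: If.
Qed.

Lemma adjoin_congr (I : A -> Prop) a b : ideal I -> I (a - b) ->
  adjoin I a = adjoin I b.
Proof.
move=> hI; suff H c d : I (c - d) -> forall x, adjoin I c x -> adjoin I d x.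
  move=> Iab; apply: eq_ideal => x; split; apply: H => //.
  by rewrite -opprB; apply: ideal_opp.
move=> Icd x [y hy]; exists y.
by rewrite (_ : _ - _ = x - y * c + y * (c - d));
  [apply: ideal_add => //; apply: ideal_mull | ring].
Qed.

(* Modulo J B, whose members include the f i with i outside B, the first
   element is the product of the f i over B; killing one factor f i turns the
   remaining ones into the sequence attached to B minus i. *)
Lemma weakly_regular_esym (J : {set 'I_n} -> A -> Prop) (F B : {set 'I_n}) :
    (forall B, ideal (J B)) ->
    (forall B i, B \subset F -> i \notin B -> J B (f i)) ->
    (forall B i, B \subset F -> i \in B -> adjoin (J B) (f i) = J (B :\ i)) ->
    (forall B i x, B \subset F -> i \in B -> J B (f i * x) -> J B x) ->
  B \subset F -> weakly_regular (J B) (esym_seq #|B|).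
Proof.
move=> hJ Jf adjJ regJ; move cardB: #|B| => d;
  elim: d B cardB => [//|d IHd] B cardB BF.
have eq_prod : J B (esym d.+1 - \prod_(i in B) f i).
  by rewrite -cardB; apply: esym_congr => // i; apply: Jf.
rewrite /=; split=> [x hx|].
  have : J B (\prod_(i in B) f i * x).
    apply/(ideal_congr (hJ B) (x := esym d.+1 * x)) => //.
    by rewrite -mulrBl; apply: ideal_mulr.
  rewrite -big_enum; have : {subset enum B <= B} by move=> i; rewrite mem_enum.
  elim: (enum B) => [_|i l IHl lB]; first by rewrite big_nil mul1r.
  rewrite big_cons -mulrA => /regJ hi; apply: IHl => [j jl|].
    by apply: lB; rewrite inE jl orbT.
  by apply: hi => //; apply: lB; rewrite inE eqxx.
rewrite (adjoin_congr _ eq_prod) // -big_enum.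
have : {subset enum B <= B} by move=> i; rewrite mem_enum.
elim: (enum B) => [_|i l IHl lB].
  rewrite big_nil; apply: weakly_regular_unit; first exact: ideal_adjoin.
  exact: adjoin_gen.
have iB : i \in B by apply: lB; rewrite inE eqxx.
rewrite big_cons; set g := \prod_(j <- l) f j in IHl *.
(* Splitting along [f i], the colon ideal drops this factor from the product, and the sum is
   [J (B :\ i)], where the induction on the size of [B] applies. *)
apply: (@weakly_regular_split _ _ (f i)); first exact: ideal_adjoin.
  suff -> : colon (adjoin (J B) (f i * g)) (f i) = adjoin (J B) g.
    by apply: IHl => j jl; apply: lB; rewrite inE jl orbT.
  apply: eq_ideal => x; split=> -[c hc]; exists c; last first.
    by rewrite (_ : _ - _ = f i * (x - c * g)); [apply: ideal_mull | ring].
  by apply: (regJ B i) => //; rewrite (_ : _ * _ = x * f i - c * (f i * g)) //;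
    ring.
suff -> : adjoin (adjoin (J B) (f i * g)) (f i) = J (B :\ i).
  apply: IHd; last exact: subset_trans (subD1set _ _) BF.
  by move: cardB; rewrite (cardsD1 i) iB => -[].
rewrite -(adjJ B i) //; apply: eq_ideal => x; split.
  apply: adjoin_min; first exact: ideal_adjoin.
    apply: adjoin_min; first exact: ideal_adjoin.
      exact: sub_adjoin.
    by apply: ideal_mulr; [apply: ideal_adjoin | apply: adjoin_gen].
  exact: adjoin_gen.
apply: adjoin_min; first by do 2!apply: ideal_adjoin.
  by move=> y hy; do 2!apply: sub_adjoin.
by apply: adjoin_gen; apply: ideal_adjoin.
Qed.

End ElementarySymmetric.

(** Descending induction on r: the coefficient of q p in degree r + deg q is p_r plus multiples of
    higher coefficients of p, which lie in [J]. *)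
Lemma monic_mul_coef_ideal (A : comNzRingType) (J : A -> Prop)
  (q p : {poly A}) :
  ideal J -> q \is monic -> (forall r, J (q * p)`_r) -> forall r, J p`_r.
Proof.
move=> hJ mon_q Jqp; suff H t r : (size p <= r + t)%N -> J p`_r.
  by move=> r; apply: (H (size p)); rewrite leq_addl.
elim: t r => [|t IHt] r; first by rewrite addn0 => /(nth_default 0) ->;
  apply: ideal0.
move=> sp; have sq0 : (0 < size q)%N by rewrite size_poly_gt0 monic_neq0.
pose e := (size q).-1; have qe : q`_e = 1 by move/monicP: mon_q;
  rewrite lead_coefE.
have er : (e < (r + e).+1)%N by rewrite ltnS leq_addl.
have := Jqp (r + e)%N; rewrite coefM (bigD1 (Ordinal er)) //= qe mul1r addnK.
apply: (ideal_congr hJ _).1; rewrite addrAC subrr add0r.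
apply: ideal_sum => // l le; have {le} : (l : nat) != e by [].
rewrite neq_ltn => /orP[le|el].
  apply: ideal_mull => //; apply: IHt.
  apply: leq_trans sp _; rewrite -(addnBA _ (ltnW le)) -addnA leq_add2l.
  by rewrite -add1n leq_add2r subn_gt0.
by rewrite nth_default ?mul0r; [apply: ideal0 | rewrite -(prednK sq0)].
Qed.

(** * Monic polynomials in single variables *)

Section Univariate.
Variables (k : fieldType) (n : nat).
Implicit Types (q : {poly k}) (p : {mpoly k[n]}) (i j : 'I_n).

Definition poly_var q i : {mpoly k[n]} := (map_poly (@mpolyC n k) q).['X_i].

(** A polynomial is viewed as one in x_j whose coefficients, kept in the full ring, avoid x_j;
    evaluating at x_j recovers it. *)
Lemma isolate_variable j :
  exists phi : {rmorphism {mpoly k[n]} -> {poly {mpoly k[n]}}},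
    (forall c, phi c%:MP = (c%:MP)%:P) /\
    (forall i, phi 'X_i = if i == j then 'X else ('X_i)%:P).
Proof.
exists (mmap (polyC \o @mpolyC n k)
  (fun i => if i == j then 'X else ('X_i)%:P)).
by split=> [c|i]; rewrite /= ?mmapC // mmapX mmap1U.
Qed.

Lemma poly_varXM q i : poly_var ('X * q) i = 'X_i * poly_var q i.
Proof. by rewrite /poly_var rmorphM /= map_polyX hornerM hornerX. Qed.

Section IsolateVariable.
Variables (j : 'I_n) (phi : {rmorphism {mpoly k[n]} -> {poly {mpoly k[n]}}}).
Hypotheses (phiC : forall c, phi c%:MP = (c%:MP)%:P)
  (phiX : forall i, phi 'X_i = if i == j then 'X else ('X_i)%:P).

Lemma isolate_horner p : (phi p).['X_j] = p.
Proof.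
elim/mpoly_ring_ind: p => [c|i|p p' hp hp'|p p' hp hp'].
- by rewrite phiC hornerC.
- by rewrite phiX; case: eqP => [->|_]; rewrite ?hornerX ?hornerC.
- by rewrite rmorphD hornerD hp hp'.
- by rewrite rmorphM hornerM hp hp'.
Qed.

Lemma isolate_poly_var i q :
  phi (poly_var q i)
  = if i == j then map_poly (@mpolyC n k) q else (poly_var q i)%:P.
Proof.
rewrite /poly_var -horner_map phiX -map_poly_comp /=.
have -> : map_poly (phi \o @mpolyC n k) q
    = map_poly polyC (map_poly (@mpolyC n k) q).
  by rewrite -map_poly_comp; apply: eq_map_poly => c /=; apply: phiC.
by case: eqP => _; [rewrite -[RHS]comp_polyXr | rewrite horner_map].
Qed.

(** The generators are constant in x_j, so membership passes to the coefficients in x_j; there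
    [poly_var q j] becomes the monic polynomial [q], which cancels. *)
Lemma poly_var_regular (G : {mpoly k[n]} -> Prop) q p :
  (forall g, G g -> phi g = g%:P) -> q \is monic ->
  ideal_gen G (poly_var q j * p) -> ideal_gen G p.
Proof.
move=> Gj mon_q hqp; have hG := ideal_gen_ideal G.
have coef_ideal x : ideal_gen G x -> forall r, ideal_gen G (phi x)`_r.
  move=> /(_ (fun x => forall r, ideal_gen G (phi x)`_r)); apply.
    split=> [r|y z hy hz r|a y hy r].
    - by rewrite rmorph0 coef0; apply: ideal0.
    - by rewrite rmorphD coefD; apply: (ideal_add hG).
    - by rewrite rmorphM coefM; apply: (ideal_sum _ hG) => l _;
      apply: (ideal_mull _ hG).
  move=> g Gg r; rewrite Gj // coefC; case: eqP => _; last exact: ideal0.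
  exact: ideal_gen_in.
rewrite -(isolate_horner p) horner_coef; apply: (ideal_sum _ hG) => l _.
apply: (ideal_mulr _ hG).
apply: (@monic_mul_coef_ideal _ _ (map_poly (@mpolyC n k) q)) => //.
  exact: monic_map.
by move=> r; have := coef_ideal _ hqp r; rewrite rmorphM isolate_poly_var eqxx.
Qed.

End IsolateVariable.

Lemma ideal_gen_sub (G H : {mpoly k[n]} -> Prop) :
  (forall g, G g -> ideal_gen H g) -> forall p, ideal_gen G p -> ideal_gen H p.
Proof. by move=> GH p hp; apply: hp => //; apply: ideal_gen_ideal. Qed.

Lemma weakly_regular_simplex (q : 'I_n -> {poly k}) (F : {set 'I_n}) :
  (forall i, q i \is monic) ->
  weakly_regular (face_ideal (powerset F))
    (esym_seq (fun i => poly_var ('X * q i) i) #|F|).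
Proof.
move=> mon_q; pose f i := poly_var ('X * q i) i.
(* [J B] kills the variables outside [F] and the [f i] with i in [F] outside [B]. The factor ['X]
   makes [f i] a multiple of ['X_i], so [J B] contains every [f i] with i outside [B]. *)
pose h i := if i \in F then f i else 'X_i.
pose J (B : {set 'I_n}) := ideal_gen (fun g => exists2 i, i \notin B & g = h i).
have hJ B : ideal (J B) by apply: ideal_gen_ideal.
have cF : simplicial_complex (powerset F).
  by move=> G H HG; rewrite !powersetE; apply: subset_trans.
have <- : J F = face_ideal (powerset F).
  apply: eq_ideal => p; split=> [|hp].
    apply; first exact: ideal_face_ideal.
    move=> _ [i iF ->]; rewrite /h (negPf iF); apply: face_idealX.
    rewrite powersetE; apply: contra iF => /subsetP; apply.
    by rewrite inE mnm1E eqxx.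
  apply: ideal_mpolyX => // m pm.
  have /subsetPn[i im iF] : ~~ (mnm_support m \subset F).
    by apply: contraNN pm => mF; rewrite hp // powersetE.
  have le_m : (U_(i) <= m)%MM by rewrite lep1mP; move: im; rewrite inE.
  rewrite -(submK le_m) mpolyXD; apply: (ideal_mull _ (hJ F));
    apply: ideal_gen_in.
  by exists i; rewrite // /h (negPf iF).
apply: (@weakly_regular_esym _ _ f J F) => //.
- move=> B i BF iB; have : J B (h i) by apply: ideal_gen_in; exists i.
  by rewrite /h; case: ifP => // _; rewrite /f poly_varXM; apply: ideal_mulr.
- move=> B i BF iB; have fi : f i = h i by rewrite /h (subsetP BF).
  apply: eq_ideal => x; split.
    apply: adjoin_min => //; last first.
      by rewrite fi; apply: ideal_gen_in; exists i; rewrite ?setD11.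
    apply: ideal_gen_sub => _ [j jB ->]; apply: ideal_gen_in; exists j => //.
    by rewrite !inE negb_and jB orbT.
  apply; first exact: ideal_adjoin.
  move=> _ [j jB ->]; have [->|ji] := eqVneq j i; first by rewrite -fi;
    apply: adjoin_gen.
  apply: sub_adjoin; apply: ideal_gen_in; exists j => //;
    apply: contra jB => jB.
  by rewrite !inE ji.
- move=> B j p BF jB; have [phi [phiC phiX]] := isolate_variable j.
  apply: (poly_var_regular phiC phiX); last by rewrite monicMl ?monicX.
  move=> _ [i iB ->]; have ij : i != j by apply: contraNneq iB => ->.
  by rewrite /h; case: ifP => _;
    rewrite ?(isolate_poly_var phiC phiX) ?phiX (negPf ij).
Qed.

End Univariate.

Lemma maximal_ideal_regular_seq (k : fieldType) (n d : nat)
  (D : {set {set 'I_n}})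
    (M : {mpoly k[n]} -> Prop) :
  simplicial_complex D -> shellable D ->
    (forall F, F \in facets D -> #|F| = d) ->
  maximal_ideal M ->
  exists s, [/\ size s = d, forall x, x \in s -> M x
    & weakly_regular (face_ideal D) s].
Proof.
move=> cD [_ [sh hsh]] card_facet hM; have hI : ideal M by case: hM.
have /choice[q hq] : forall i : 'I_n, exists q : {poly k},
    q \is monic /\ M (poly_var q i).
  by move=> i; have [q mon_q Mq] := maximal_ideal_monic 'X_i hM; exists q.
exists (esym_seq (fun i => poly_var ('X * q i) i) d); split.
- exact: size_esym_seq.
- move=> x; apply: esym_seq_ideal => // i.
  by rewrite poly_varXM; apply: ideal_mull => //; case: (hq i).
apply: weakly_regular_shelling hsh _ => // F FD.
by rewrite -(card_facet F FD); apply: weakly_regular_simplex => i; case: (hq i).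
Qed.

(** * Dimension of face rings *)

(* The exponents of T with lexicographically least initial segment survive: as
   a j lies in p j.+1 but not in p j, the sum may be divided by the common power
   of a j, and its terms still divisible by a j dropped, on passing from p j to
   p j.+1. *)
Lemma prime_chain_independent (A : comPzRingType) (N : nat)
    (p : nat -> A -> Prop) (a : nat -> A) (E : finType) (e : E -> 'I_N -> nat)
    (c : E -> A) :
  (forall i, (i <= N)%N -> prime_ideal (p i)) ->
  (forall i, (i < N)%N -> forall x, p i x -> p i.+1 x) ->
  (forall i, (i < N)%N -> p i.+1 (a i) /\ ~ p i (a i)) ->
  (forall u v, e u =1 e v -> u = v) ->
  forall T : {set E}, T != set0 -> (forall u, u \in T -> ~ p N (c u)) ->
  ~ p 0%N (\sum_(u in T) c u * \prod_(i < N) a i ^+ e u i).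
Proof.
move=> p_prime p_sub pa e_inj T T0 cT p0.
(* Generalized to a subfamily [U] agreeing in the first [j] exponents, the corresponding factors
   being divided out. *)
suff H j (U : {set E}) : (j <= N)%N -> U != set0 -> U \subset T ->
    (forall u v, u \in U -> v \in U -> forall i : 'I_N, (i < j)%N ->
      e u i = e v i) ->
    ~ p j (\sum_(u in U) c u * \prod_(i < N | (j <= i)%N) a i ^+ e u i).
  by apply: (H 0%N T).
move: {2}(N - j)%N (erefl (N - j)%N) => t;
  elim: t j U => [|t IHt] j U jt jN U0 UT eU pj.
  (* At [j = N], injectivity of [e] leaves one term, a coefficient outside [p N]. *)
  have jN' : j = N by apply/eqP; rewrite eqn_leq jN -subn_eq0 jt.
  subst j; have [u uU] := set0Pn _ U0.
  apply: (cT u (subsetP UT u uU)); move: pj; rewrite (big_pred1 u) => [|v].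
    by rewrite big_pred0 ?mulr1 // => i; rewrite leqNgt ltn_ord.
  apply/idP/eqP=> [vU|->//]; apply: e_inj => i;
    exact: (eU _ _ vU uU i (ltn_ord i)).
have lt_jN : (j < N)%N by rewrite -subn_gt0 jt.
pose j' := Ordinal lt_jN; have [u0 u0U] := set0Pn _ U0.
pose um := [arg min_(u < u0 in U) e u j']; have [umU um_min] : um \in U /\
    forall u, u \in U -> (e um j' <= e u j')%N.
  by rewrite /um; case: arg_minnP => // u uU hu; split.
set r := e um j' in um_min.
pose rest u := \prod_(i < N | (j.+1 <= i)%N) a i ^+ e u i.
have prodE u : u \in U -> \prod_(i < N | (j <= i)%N) a i ^+ e u i
    = a j ^+ r * (a j ^+ (e u j' - r) * rest u).
  move=> uU; rewrite mulrA -exprD subnKC ?um_min // (bigD1 j') //=;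
    congr (_ * _).
  by apply: eq_bigl => i; rewrite ltn_neqAle andbC eq_sym.
have [_ _ pj_prime] := p_prime j jN; have [aj aj'] := pa j lt_jN.
have [pjS_ideal _ _] := p_prime j.+1 lt_jN.
have {pj} pj : p j.+1 (\sum_(u in U) c u * (a j ^+ (e u j' - r) * rest u)).
  apply: p_sub => //; move: pj; rewrite (eq_bigr (fun u =>
    a j ^+ r * (c u * (a j ^+ (e u j' - r) * rest u)))); last first.
    by move=> u uU; rewrite prodE // mulrCA.
  rewrite -mulr_sumr; move: (\sum_(u in U) _) => x; elim: (r) => [|r' IHr];
    first by rewrite mul1r.
  by rewrite exprS -mulrA => /pj_prime[/aj'//|h]; apply: IHr.
apply: (IHt j.+1 [set u in U | e u j' == r]) => //.
- by rewrite subnS jt.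
- by apply/set0Pn; exists um; rewrite inE umU eqxx.
- by apply/subsetP=> u; rewrite inE => /andP[/(subsetP UT)].
- move=> u v; rewrite !inE => /andP[uU /eqP ur] /andP[vU /eqP vr] i.
  rewrite ltnS leq_eqVlt => /predU1P[ij|]; last exact: eU.
  by have -> : i = j' by [apply: val_inj]; rewrite ur vr.
move: pj; rewrite (bigID (fun u => e u j' == r)) /= =>
  /(ideal_congr pjS_ideal _).1 h.
rewrite (eq_bigl (fun u => (u \in U) && (e u j' == r))); last by move=> u;
  rewrite inE.
rewrite (eq_bigr (fun u => c u * (a j ^+ (e u j' - r) * rest u))); last first.
  by move=> u /andP[_ /eqP ->]; rewrite subnn mul1r.
apply: h; rewrite addrAC subrr add0r; apply: ideal_sum => // u /andP[uU ur].
have lt_r : (0 < e u j' - r)%N by rewrite subn_gt0 ltn_neqAle eq_sym ur um_min.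
apply: ideal_mull => //; apply: ideal_mulr => //.
by rewrite -(prednK lt_r) exprS; apply: ideal_mulr.
Qed.

(** * Counting monomials supported on faces *)

Section Growth.
Variables (k : fieldType) (n : nat).
Implicit Types (p q : {mpoly k[n]}).

Definition mdeg_bounded p e := forall m, m \in msupp p -> (mdeg m <= e)%N.

Lemma mdeg_boundedM p q e1 e2 :
  mdeg_bounded p e1 -> mdeg_bounded q e2 -> mdeg_bounded (p * q) (e1 + e2).
Proof.
move=> hp hq _ /msuppM_le/allpairsP[[m1 m2] /= [m1p m2q ->]].
by rewrite mdegD leq_add ?hp ?hq.
Qed.

Lemma mdeg_bounded1 : mdeg_bounded 1 0.
Proof. by move=> m; rewrite msupp1 inE => /eqP->; rewrite mdeg0. Qed.

Lemma mdeg_boundedX p e r : mdeg_bounded p e -> mdeg_bounded (p ^+ r) (e * r).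
Proof.
move=> hp; elim: r => [|r IHr]; first by rewrite muln0; apply: mdeg_bounded1.
by rewrite exprS mulnS; apply: mdeg_boundedM.
Qed.

Lemma mdeg_bounded_prod N (b : 'I_N -> {mpoly k[n]}) e :
  (forall i, mdeg_bounded (b i) e) -> mdeg_bounded (\prod_i b i) (N * e).
Proof.
elim: N b => [|N IHN] b hb; first by rewrite big_ord0; apply: mdeg_bounded1.
by rewrite big_ord_recl mulSn; apply: mdeg_boundedM => //; apply: IHN.
Qed.

(** Sort the exponent vectors by support: a face F supports at most (L + 1)^|F| of them. *)
Lemma card_face_exponents (D : {set {set 'I_n}}) d L :
  (forall F, F \in D -> (#|F| <= d)%N) ->
  (#|[set x : {ffun 'I_n -> 'I_L.+1} | [set i | x i != ord0] \in D]| <= #|D| *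
    L.+1 ^ d)%N.
Proof.
move=> hD; rewrite -sum1_card.
rewrite (partition_big (fun x : {ffun 'I_n -> 'I_L.+1} =>
  [set i | x i != ord0]) (mem D)); last first.
  by move=> x; rewrite inE.
rewrite -sum_nat_const; apply: leq_sum => F FD.
apply: (@leq_trans (L.+1 ^ #|F|)); last by rewrite leq_pexp2l // hD.
rewrite -[X in (X ^ _)%N](card_ord L.+1) -(@card_pffun_on _ _ (ord0 : 'I_L.+1))
  sum1_card.
apply/subset_leq_card/subsetP=> x /andP[_ /eqP xF].
apply/pffun_onP; split=> //; apply/subsetP=> i.
by rewrite -xF !inE.
Qed.

(** There are M^N products with exponents below M, of degree at most linear in M, but only O(M^d)
    face monomials up to that degree; as N > d, a large M forces a linear relation. *)
Lemma face_ideal_dependent (D : {set {set 'I_n}}) d N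
  (b : 'I_N -> {mpoly k[n]}) :
  (forall F, F \in D -> (#|F| <= d)%N) -> (d < N)%N ->
  exists M, exists c : {ffun 'I_N -> 'I_M} -> k, (exists u, c u != 0) /\
    face_ideal D (\sum_u c u *: \prod_i b i ^+ u i).
Proof.
move=> hD dN; pose e := (\max_i msize (b i))%N.
have hb i : mdeg_bounded (b i) e.
  move=> m /msize_mdeg_lt/ltnW le_m; apply: leq_trans le_m _.
  by rewrite /e; apply: (leq_bigmax i).
(* With this choice |D| (L + 1)^d <= |D| (N e + 1)^d M^d < M^(d + 1) <= M^N, where [L] bounds the
   degrees of the products. *)
pose M := (#|D| * (N * e).+1 ^ d).+1; exists M; pose L := (N * (e * M))%N.
have hprod (u : {ffun 'I_N -> 'I_M}) : mdeg_bounded (\prod_i b i ^+ u i) L.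
  apply: mdeg_bounded_prod => i m hm;
    apply: leq_trans (mdeg_boundedX (hb i) hm) _.
  by rewrite leq_mul2l ltnW ?orbT.
pose XD := [set x : {ffun 'I_n -> 'I_L.+1} | [set i | x i != ord0] \in D].
pose mon (x : {ffun 'I_n -> 'I_L.+1}) : 'X_{1..n} :=
  [multinom nat_of_ord (x i) | i < n].
pose E := {ffun 'I_N -> 'I_M}.
(* Rows are the products, columns the face monomials; a vector of the left kernel is a linear
   relation modulo the face ideal. *)
pose B : 'M[k]_(#|E|, #|XD|) := \matrix_(i, j)
  (\prod_l b l ^+ (enum_val i : E) l)@_(mon (enum_val j)).
have lt_card : (#|XD| < #|E|)%N.
  apply: leq_ltn_trans (card_face_exponents _ hD) _.
  rewrite card_ffun !card_ord; apply: (@leq_trans (M ^ d.+1));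
    last by rewrite leq_pexp2l.
  rewrite expnS; apply: (@leq_ltn_trans (#|D| * ((N * e).+1 ^ d) * M ^ d)).
    rewrite -mulnA leq_mul2l -expnMn; apply/orP; right.
    case: (d) => // d'; rewrite leq_exp2r // /L mulnA -addn1.
    by rewrite -(addn1 (N * e)) mulnDl mul1n leq_add2l.
  by rewrite ltn_pmul2r ?expn_gt0.
have [v v0 vB] : exists2 v : 'rV_#|E|, v != 0 & v *m B = 0.
  have : kermx B != 0.
    rewrite -mxrank_eq0 mxrank_ker subn_eq0 -ltnNge.
    exact: leq_ltn_trans (rank_leq_col B) lt_card.
  move=> /rowV0Pn[v vK v0]; exists v => //; exact/sub_kermxP.
exists (fun u => v 0 (enum_rank u)); split.
  have [i vi] : exists i, v 0 i != 0.
    by apply/existsP; apply: contraNT v0 => /existsPn v0; apply/eqP/rowP=> i;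
      rewrite mxE; apply/eqP; rewrite -[_ == _]negbK.
  by exists (enum_val i); rewrite enum_valK.
move=> m mD; rewrite raddf_sum /=.
have [mL|Lm] := leqP (mdeg m) L; last first.
  rewrite big1 // => u _; rewrite mcoeffZ memN_msupp_eq0 ?mulr0 //.
  by apply/negP=> /hprod; rewrite leqNgt Lm.
have le_m i : (m i < L.+1)%N.
  by rewrite ltnS (leq_trans _ mL) // mdegE (bigD1 i) //= leq_addr.
pose x : {ffun 'I_n -> 'I_L.+1} := [ffun i => Ordinal (le_m i)].
have mon_x : mon x = m by apply/mnmP=> i; rewrite mnmE ffunE.
have xD : x \in XD.
  rewrite inE; suff -> : [set i | x i != ord0] = mnm_support m by [].
  by apply/setP=> i; rewrite !inE ffunE.
have := congr1 (fun w : 'rV_#|XD| => w 0 (enum_rank_in xD x)) vB.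
rewrite !mxE => vB0; rewrite -[RHS]vB0 [RHS](reindex enum_rank) /=;
  last exact/onW_bij/enum_rank_bij.
apply: eq_bigr => u _.
by rewrite mcoeffZ !mxE enum_rankK_in // mon_x enum_rankK.
Qed.

End Growth.

(** Pick [a i] in [p i.+1] outside [p i]. If r > d, they satisfy a polynomial relation over k modulo
    the face ideal, hence modulo [p 0]; [prime_chain_independent] forbids this, nonzero constants
    lying in no prime. *)
Lemma face_ideal_prime_chain (k : fieldType) (n d r : nat)
  (D : {set {set 'I_n}})
    (p : nat -> {mpoly k[n]} -> Prop) :
  (forall F, F \in D -> (#|F| <= d)%N) ->
  (forall i, (i <= r)%N -> prime_ideal (p i)) ->
  (forall i, (i < r)%N -> Defs.proper_sub (p i) (p i.+1)) ->
  (forall x, face_ideal D x -> p 0%N x) -> (r <= d)%N.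
Proof.
move=> hD p_prime p_lt Dp; rewrite leqNgt; apply/negP=> dr.
have /choice[a pa] : forall i, exists x, (i < r)%N -> p i.+1 x /\ ~ p i x.
  move=> i; have [ir|_] := boolP (i < r)%N; last by exists 0.
  by have [_ [x px px']] := p_lt i ir; exists x.
have [M [c [[u0 cu0] hc]]] := face_ideal_dependent (fun i : 'I_r => a i) hD dr.
pose T := [set u | c u != 0].
have T0 : T != set0 by apply/set0Pn; exists u0; rewrite inE.
have [_ pr1 _] := p_prime r (leqnn r); have [hr _ _] := p_prime r (leqnn r).
pose e (u : {ffun 'I_r -> 'I_M}) (i : 'I_r) := nat_of_ord (u i).
apply: (@prime_chain_independent _ r p a _ e
  (fun u => (c u)%:MP) p_prime _ pa _ T T0).
- by move=> i /p_lt[].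
- by move=> u v uv; apply/ffunP=> i; apply: val_inj; apply: uv.
- move=> u; rewrite inE => cu pc; apply: pr1.
  by rewrite -mpolyC1 -(mulVf cu) mpolyCM; apply: ideal_mull.
apply: Dp; suff -> : \sum_(u in T) (c u)%:MP * \prod_(i < r) a i ^+ u i
  = \sum_u c u *: \prod_(i < r) a i ^+ u i by [].
rewrite big_mkcond; apply: eq_bigr => u _; rewrite inE mul_mpolyC.
by case: eqVneq => // ->; rewrite scale0r.
Qed.

(** * Cohen-Macaulayness of shellable complexes *)

Section Surjection.
Variables (A B : comPzRingType) (f : {rmorphism A -> B}).
Hypothesis f_surj : forall y, exists x, y = f x.

Lemma weakly_regular_surj (J : B -> Prop) s :
  weakly_regular (fun x => J (f x)) s -> weakly_regular J (map f s).
Proof.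
elim: s J => [//|a s IHs] J /= [reg_a reg_s]; split.
  by move=> y; have [x ->] := f_surj y; rewrite -rmorphM; apply: reg_a.
apply: IHs; suff -> : (fun x => adjoin J (f a) (f x)) = adjoin
  (fun x => J (f x)) a by [].
apply: eq_ideal => x; split=> -[c]; last by exists (f c);
  rewrite -rmorphM -rmorphB.
by have [b ->] := f_surj c; rewrite -rmorphM -rmorphB; exists b.
Qed.

Lemma prime_ideal_preim (P : B -> Prop) :
  prime_ideal P -> prime_ideal (fun x => P (f x)).
Proof.
case=> hP P1 primeP; split=> [||x y]; first exact: ideal_preim.
  by rewrite rmorph1.
by rewrite rmorphM => /primeP.
Qed.

Lemma maximal_ideal_preim (P : B -> Prop) :
  maximal_ideal P -> maximal_ideal (fun x => P (f x)).
Proof.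
case=> hP P1 maxP; split=> [||J hJ J1 PJ x Jx]; first exact: ideal_preim.
  by rewrite rmorph1.
pose K y := exists2 x, J x & y = f x.
have KJ z : K (f z) -> J z.
  move=> [t Jt zt]; rewrite -(subrK t z); apply: ideal_add => //; apply: PJ.
  by rewrite rmorphB zt subrr; apply: ideal0.
apply: (maxP K); last by exists x.
- split=> [|_ _ [t Jt ->] [u Ju ->]|b _ [t Jt ->]].
  + by exists 0; rewrite ?rmorph0 //; apply: ideal0.
  + by exists (t + u); rewrite ?rmorphD //; apply: ideal_add.
  + have [a ->] := f_surj b.
    by exists (a * t); rewrite ?rmorphM //; apply: ideal_mull.
- by rewrite -(rmorph1 f) => /KJ.
- by move=> y; have [t ->] := f_surj y; move=> /PJ Jt; exists t.
Qed.

End Surjection.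

Theorem shellable_cohen_macaulay (k : fieldType) (n : nat)
  (D : {set {set 'I_n}}) :
  simplicial_complex D -> shellable D ->
    cohen_macaulay (stanley_reisner_ring k D).
Proof.
move=> cD shD; pose pi : {rmorphism {mpoly k[n]} -> stanley_reisner_ring k D} :=
  quot_pi (@nonface_monomial k n D).
have pi_surj : forall y, exists x, y = pi x by apply: quot_pi_surj.
have pi0 x : pi x = 0 <-> face_ideal D x.
  by rewrite -stanley_reisner_idealE //; apply: quot_pi_eq0.
split; first exact: noetherian_surj pi_surj (@noetherian_mpoly k n).
move=> P maxP; have maxM := maximal_ideal_preim pi_surj maxP.
have [hP P1 _] := maxP; have primeP := maximal_ideal_prime maxP.
(* The void complex gives the zero ring, which has no maximal ideal. *)
have D0 : D != set0.
  apply/eqP=> D0; apply: P1; rewrite -(rmorph1 pi) (_ : pi 1 = 0);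
    first exact: ideal0.
  by apply/pi0=> m; rewrite D0 inE.
have [G GD] := set0Pn _ D0; have [F0 F0D _] := facet_exists GD.
have [pD _] := shD; pose d := #|F0|.
have card_facet F : F \in facets D -> #|F| = d by move=> FD; apply: pD.
have card_face F : F \in D -> (#|F| <= d)%N.
  by move=> /facet_exists[H HD /subset_leq_card]; rewrite (card_facet H).
have chain_le r : prime_chain P r -> (r <= d)%N.
  move=> [p [p_prime p_lt _]].
  apply: (@face_ideal_prime_chain k n d r D (fun i x => p i (pi x))) => //.
  - by move=> i /p_prime; apply: prime_ideal_preim.
  - move=> i /p_lt[p_sub [y py py']]; split=> [x|]; first exact: p_sub.
    by have [x yx] := pi_surj y; exists x; rewrite -yx.
  - move=> x /pi0 ->; have [p0 _ _] := p_prime 0%N (leq0n _); exact: ideal0.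
have [s [size_s sM reg_s]] := maximal_ideal_regular_seq cD shD card_facet maxM.
have sP y : y \in map pi s -> P y by move=> /mapP[x /sM Mx ->].
have reg_pi_s : weakly_regular (fun y => y = 0) (map pi s).
  apply: weakly_regular_surj => //.
  suff -> : (fun x => pi x = 0) = face_ideal D by [].
  exact: eq_ideal.
(* Regular sequences in [P] yield chains of primes below [P], so the bound on chains also bounds the
   depth, while the sequence found above attains the height. *)
have regular_chain t : weakly_regular (fun y => y = 0) t ->
    (forall y, y \in t -> P y) -> prime_chain P (size t).
  move=> reg_t tP; apply: weakly_regular_prime_chain tP reg_t => //.
    exact: ideal_zero.
  by move=> _ ->; apply: ideal0.
exists d; split; split.
- by rewrite -size_s -(size_map pi); apply: regular_chain.
- exact: chain_le.
- exists (map pi s); split=> //; last by rewrite size_map.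
  by apply/regular_seqE; split=> // /(_ P hP sP).
- by move=> t /regular_seqE[_ reg_t] tP; apply/chain_le/regular_chain.
Qed.

Theorem theorem5 (W : groupType) (S : W -> Prop) (m : nat) (Q : m.-tuple W)
    (w : W) (hS : coxeter_system S) (hQ : word S Q) :
  let D := subword_complex S Q w in
  [/\ D != set0 -> vertex_decomposable D,
      shellable D &
      forall k : fieldType, cohen_macaulay (stanley_reisner_ring k D)].
Proof.
move=> D; have Qi i : S (tnth Q i) by apply: hQ; apply: mem_tnth.
have cD : simplicial_complex D.
  by rewrite /D subword_complexE; apply: position_complex_closed.
have vdD : D != set0 -> vertex_decomposable D.
  rewrite /D subword_complexE;
    apply: position_complex_vertex_decomposable => //.
  exact: enum_uniq.
have shD : shellable D.
  have [->|/vdD vd] := eqVneq D set0; first exact: void_shellable.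
  exact: vertex_decomposable_shellable.
by split=> // k; apply: shellable_cohen_macaulay.
Qed.
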